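(* For every integer $d\ge 0$ there exists a polynomial $Q$ (depending only on $d$) with the following property. Let $P$ be any real polynomial of degree $d$ whose leading coefficient is irrational, let $w=(w_n)_{n\in\mathbb Z}$ be the two-sided infinite binary word defined by $w_n=[2\{P(n)\}]$, and let $T(k)$ be the number of different subwords of $w$ of length $k$. Then $T(k)=Q(k)$ for all sufficiently large $k$ (where how large $k$ must be may depend on $P$).
   Context: $[\cdot]$ denotes the integer part and $\{\cdot\}$ the fractional part of a real number, so $w_n\in\{0,1\}$ is the first binary digit of $\{P(n)\}$. A subword of $w$ of length $k$ is a word of the form $w_nw_{n+1}\cdots w_{n+k-1}$ with $n\in\mathbb Z$. *)

(* Defs.v *)
From mathcomp Require Import all_boot all_order all_algebra finmap.
From mathcomp Require Import boolp classical_sets cardinality reals.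

Set Implicit Arguments.
Unset Strict Implicit.
Unset Printing Implicit Defensive.

Import Order.TTheory GRing.Theory Num.Theory.

Local Open Scope classical_set_scope.
Local Open Scope ring_scope.

Definition fracp (R : realType) (x : R) : R := x - (Num.floor x)%:~R.

Definition polyword (R : realType) (P : {poly R}) (n : int) : int :=
  Num.floor (2 * fracp P.[n%:~R]).

Definition subword (A : Type) (w : int -> A) (k : nat) (n : int) : k.-tuple A :=
  [tuple w (n + (val i)%:Z) | i < k].

Definition subwords (A : Type) (w : int -> A) (k : nat) : set (k.-tuple A) :=
  range (subword w k).
Arguments subwords {A} w k _.

(* [fset_set] is empty on infinite sets; [finite_subwords] below shows that this
   junk value is never met for the words [polyword P]. *)
Definition complexity (A : choiceType) (w : int -> A) (k : nat) : nat :=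
  #|` fset_set (subwords w k)|%fset.

Lemma polyword_binary (R : realType) (P : {poly R}) (n : int) :
  polyword P n = 0 \/ polyword P n = 1.
Proof.
rewrite /polyword /fracp; set x := P.[_].
have x0 : 0 <= x - (Num.floor x)%:~R by rewrite subr_ge0 floor_le.
have x1 : x - (Num.floor x)%:~R < 1.
  by rewrite ltrBlDr addrC -[X in _ + X]/(1%:~R) -intrD floorD1_gt.
set y := x - _ in x0 x1 *.
have [yl|yl] := ltP (2 * y) 1.
  by left; apply/floor_def; rewrite add0r mulr_ge0.
right; apply/floor_def; rewrite yl /= (_ : (1 + 1)%:~R = 2 * 1).
  by rewrite ltr_pM2l.
by rewrite mulr1.
Qed.

Lemma finite_subwords (R : realType) (P : {poly R}) (k : nat) :
  finite_set (subwords (polyword P) k).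
Proof.
pose f (t : k.-tuple bool) : k.-tuple int := map_tuple (fun b : bool => b : int) t.
apply: (@sub_finite_set _ _ (f @` [set: k.-tuple bool])); last first.
  by apply: finite_image; exact: finite_finset.
move=> _ [n _ <-]; exists (subword (fun m => polyword P m == 1) k n) => //.
apply: eq_from_tnth => i; rewrite tnth_map !tnth_mktuple.
by have [->|->] := polyword_binary P (n + (val i)%:Z).
Qed.

(* Main.v *)
Require Import Defs.
From mathcomp Require Import all_boot all_order all_algebra.
From mathcomp Require Import boolp classical_sets reals.
From mathcomp Require Import perm finmap cardinality trigo.
From mathcomp Require Import ring lra zify.

(* Write D for the difference operator.  The sequences g i = 2 P(n + i) satisfy
   D^d g = beta with beta irrational, and w_(n+i) is the parity of floor (g i).
   On the affine space of all real g with D^d g = beta, the lattice of integer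
   sequences z with D^d z = 0 acts by g |-> g + 2 z; the quotient is a torus,
   which the walls {g i is an integer}, i < k, cut into cells.
   - The arrangement is simple: interpolating at d + 1 nodes where g is an
     integer would make beta rational.  By deletion and restriction the number
     of cells is then the number of vertices, that is, the sum over
     u_1 < ... < u_d < k of the determinants of the matrices 2 'C(u_i, j), which
     are lattice indices and are positive by Vandermonde.  Expanding the
     determinants shows that this sum is a polynomial in k.
   - Every cell contains a point of the orbit, by Weyl's theorem applied to a
     Fejer kernel on the torus.
   - For large k distinct cells have distinct parity words.  If g and h have the
     same word, then sin (pi g i) sin (pi h i) >= 0 for i < k.  Averaging this
     against a Fejer kernel in (g + h) / 2, with Weyl's theorem uniform in the
     lower order terms, shows that (g - h) / 2 is close to integers on average.
     As D^d (g - h) = 0, it is then close to an integer at every i < k, hence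
     close to an integer sequence z with D^d z = 0. *)

Set Implicit Arguments.
Unset Strict Implicit.
Unset Printing Implicit Defensive.

Import Order.TTheory GRing.Theory Num.Theory.

Local Open Scope ring_scope.

(** * Finite differences *)

Definition fdiff (V : zmodType) (f : nat -> V) : nat -> V :=
  fun n => f n.+1 - f n.
Arguments fdiff {V} f n.

Section FiniteDifferences.
Variable V : zmodType.
Implicit Types (f g : nat -> V) (m n h : nat) (c : V).

Lemma iter_fdiffS m f n :
  iter m.+1 fdiff f n = iter m fdiff f n.+1 - iter m fdiff f n.
Proof. by []. Qed.

Lemma iter_fdiffD m f g n :
  iter m fdiff (fun i => f i + g i) n = iter m fdiff f n + iter m fdiff g n.
Proof.
elim: m n => // m IH n; rewrite !iter_fdiffS !IH.
by rewrite opprD addrACA.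
Qed.

Lemma iter_fdiffN m f n :
  iter m fdiff (fun i => - f i) n = - iter m fdiff f n.
Proof. by elim: m n => // m IH n; rewrite !iter_fdiffS !IH -opprD. Qed.

Lemma iter_fdiffB m f g n :
  iter m fdiff (fun i => f i - g i) n = iter m fdiff f n - iter m fdiff g n.
Proof. by rewrite iter_fdiffD iter_fdiffN. Qed.

Lemma iter_fdiff0 m n : iter m fdiff (fun=> 0 : V) n = 0.
Proof. by elim: m n => // m IH n; rewrite iter_fdiffS !IH subrr. Qed.

Lemma iter_fdiff_eq0 m f : (forall n, f n = 0) -> forall n, iter m fdiff f n = 0.
Proof. by move=> /funext -> n; exact: iter_fdiff0. Qed.

Lemma iter_fdiff_le m1 m2 f : (m1 <= m2)%N ->
  (forall n, iter m1 fdiff f n = 0) -> forall n, iter m2 fdiff f n = 0.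
Proof. by move=> /subnK <- f0 n; rewrite iterD iter_fdiff_eq0. Qed.

Lemma iter_fdiff_const m c n : (0 < m)%N -> iter m fdiff (fun=> c) n = 0.
Proof.
by case: m => // m _; rewrite iterSr iter_fdiff_eq0// => i; rewrite /fdiff subrr.
Qed.

Lemma iter_fdiff_sum (I : Type) (r : seq I) (F : I -> nat -> V) m n :
  iter m fdiff (fun i => \sum_(j <- r) F j i) n =
  \sum_(j <- r) iter m fdiff (F j) n.
Proof.
elim: m n => // m IH n; rewrite iter_fdiffS !IH -sumrB.
by apply: eq_bigr => j _; rewrite iter_fdiffS.
Qed.

Lemma iter_fdiff_shift m f h n :
  iter m fdiff (fun i => f (h + i)%N) n = iter m fdiff f (h + n)%N.
Proof. by elim: m n => // m IH n; rewrite !iter_fdiffS !IH addnS. Qed.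

Lemma iter_fdiff_comp m l f n :
  iter m fdiff (iter l fdiff f) n = iter (m + l) fdiff f n.
Proof. by rewrite iterD. Qed.

Lemma fdiff_telescope f h n :
  f (n + h)%N - f n = \sum_(r < h) fdiff f (r + n)%N.
Proof.
elim: h => [|h IH]; first by rewrite addn0 subrr big_ord0.
by rewrite big_ord_recr/= -IH /fdiff addnS (addnC n h) [RHS]addrC subrKA.
Qed.

(** Newton's forward difference formula. The induction on [m] applies the formula to [fdiff f]; the
    one on [n] adds up these increments by Pascal's rule. *)
Lemma newton m f : (forall n, iter m fdiff f n = 0) ->
  forall n, f n = \sum_(j < m) (iter j fdiff f 0) *+ 'C(n, j).
Proof.
elim: m f => [|m IH] f f0 n; first by rewrite big_ord0; exact: (f0 n).
elim: n => [|n IHn].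
  by rewrite big_ord_recl/= bin0 mulr1n big1 ?addr0.
have -> : f n.+1 = f n + fdiff f n by rewrite /fdiff addrC subrK.
rewrite [fdiff f n](IH (fdiff f)); last by move=> i; rewrite -iterSr f0.
rewrite IHn big_ord_recl [in RHS]big_ord_recl !bin0 -addrA; congr (_ + _).
rewrite -big_split/=; apply: eq_bigr => i _.
by rewrite /bump leq0n add1n -iterSr -mulrnDr -binS addnC.
Qed.

(** Summation from 0 inverts [fdiff], so the jet at 0 can be prescribed freely over any abelian
    group. This serves real and integer sequences alike. *)
Lemma fdiff_jet_ex m (c : nat -> V) : exists2 f : nat -> V,
  forall n, iter m fdiff f n = 0 &
  forall j, (j < m)%N -> iter j fdiff f 0 = c j.
Proof.
elim: m c => [|m IH] c; first by exists (fun=> 0).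
have [g g0 gc] := IH (fun j => c j.+1).
pose f n := c 0 + \sum_(u < n) g u.
have fg : fdiff f = g.
  apply/funext => n; rewrite /fdiff /f big_ord_recr/= addrA.
  by rewrite [_ + g n]addrC addrK.
exists f => [n|[|j] jm]; first by rewrite iterSr fg.
  by rewrite /= /f big_ord0 addr0.
by rewrite iterSr fg gc.
Qed.

(** At the consecutive nodes [0, ..., m - 1] interpolation needs no division, so integer values have
    an integer-valued interpolant. *)
Lemma fdiff_interp_init m (r : nat -> V) : exists2 f : nat -> V,
  forall n, iter m fdiff f n = 0 & forall j, (j < m)%N -> f j = r j.
Proof.
have [f f0 fr] := fdiff_jet_ex m (fun j => iter j fdiff r 0).
exists f => // j jm.
have H : forall i l, (i + l < m)%N -> iter l fdiff f i = iter l fdiff r i.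
  elim=> [|i IH] l; first by rewrite add0n; exact: fr.
  move=> ilm; have E (h : nat -> V) : iter l fdiff h i.+1 =
    iter l fdiff h i + iter l.+1 fdiff h i by rewrite iter_fdiffS addrC subrK.
  by rewrite !E !IH//; lia.
by apply: (H j 0); rewrite addn0.
Qed.

(** A difference of step [h] is a sum of [h] ordinary differences, so passing to an arithmetic
    progression does not raise the degree. *)
Lemma iter_fdiff_dilate m f h : (forall n, iter m fdiff f n = 0) ->
  forall a n, iter m fdiff (fun j => f (a + h * j)%N) n = 0.
Proof.
elim: m f => [|m IH] f f0 a n; first exact: f0.
rewrite iterSr.
have -> : fdiff (fun j => f (a + h * j)%N) =
   fun j => \sum_(r < h) fdiff f ((r + a) + h * j)%N.
  apply/funext => j; rewrite /fdiff mulnS addnCA addnA -addnA (addnC h).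
  by rewrite fdiff_telescope; apply: eq_bigr => r _; rewrite addnA.
rewrite iter_fdiff_sum big1// => r _.
by rewrite (IH (fdiff f))// => i; rewrite -iterSr.
Qed.

End FiniteDifferences.

Section FiniteDifferencesRing.
Variable A : comNzRingType.
Implicit Types (f g : nat -> A) (c x : A).

Lemma iter_fdiffZ c m f n :
  iter m fdiff (fun i => c * f i) n = c * iter m fdiff f n.
Proof. by elim: m n => // m IH n; rewrite !iter_fdiffS !IH mulrBr. Qed.

(** The product rule with a linear factor; it drives the inductions on products of linear factors
    and on Horner's scheme below. *)
Lemma iter_fdiff_linear_mul m f c x : (forall n, iter m fdiff f n = c) ->
  forall n, iter m.+1 fdiff (fun i => (x + i%:R) * f i) n = m.+1%:R * c.
Proof.
elim: m f => [|m IH] f fc n.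
  rewrite /= /fdiff [f n]fc [f n.+1]fc -mulrBl -natr1; ring.
have E : fdiff (fun i => (x + i%:R) * f i) =
    fun i => (x + i%:R) * fdiff f i + f (1 + i)%N.
  by apply/funext => i; rewrite /fdiff add1n -natr1; ring.
rewrite iterSr E iter_fdiffD IH; last by move=> i; rewrite -iterSr.
by rewrite iter_fdiff_shift fc -[m.+2%:R]natr1 mulrDl mul1r.
Qed.

Lemma iter_fdiff_prod_linear (S : seq nat) n :
  iter (size S).+1 fdiff (fun i => \prod_(s <- S) (i%:R - s%:R : A)) n = 0.
Proof.
elim: S n => [|s S IH] n; first by rewrite /= /fdiff !big_nil subrr.
have -> : (fun i => \prod_(s0 <- (s :: S)) (i%:R - s0%:R : A)) =
          (fun i => (- s%:R + i%:R) * \prod_(s0 <- S) (i%:R - s0%:R)).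
  by apply/funext => i; rewrite big_cons [_ - s%:R]addrC.
by rewrite (iter_fdiff_linear_mul (c := 0)) ?mulr0.
Qed.

Lemma iter_fdiff_horner (P : {poly A}) d x n : (size P <= d.+1)%N ->
  iter d fdiff (fun i => P.[x + i%:R]) n = d`!%:R * P`_d.
Proof.
elim/poly_ind: P d n => [|Q c IH] d n sP.
  by rewrite coef0 mulr0 iter_fdiff_eq0// => i; rewrite horner0.
case: d sP => [|d] sP; first by rewrite /= (size1_polyC sP) hornerC coefC/= mul1r.
have sQ : (size Q <= d.+1)%N.
  by move: sP; rewrite size_MXaddC; case: ifP => // /andP[/eqP ->]; rewrite size_poly0.
have -> : (fun i => (Q * 'X + c%:P).[x + i%:R]) =
    fun i => (x + i%:R) * Q.[x + i%:R] + c.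
  by apply/funext => i; rewrite !hornerE mulrC.
rewrite iter_fdiffD iter_fdiff_const// addr0.
rewrite (iter_fdiff_linear_mul (c := d`!%:R * Q`_d)); last by move=> i; exact: IH.
by rewrite coefD coefMX coefC/= addr0 factS natrM mulrA.
Qed.

End FiniteDifferencesRing.

(** * Polynomial sequences and binomial determinants *)

Definition fdiff_nilpotent (V : zmodType) (f : nat -> V) : Prop :=
  exists m, forall n, iter m fdiff f n = 0.

Section PolynomialSequences.
Variable A : comNzRingType.
Implicit Types (f g : nat -> A).

(** Induction on [m1 + m2] by the rule [D(fg) = Df * g(1 + .) + f * Dg]: each term loses one order
    in one factor. *)
Lemma iter_fdiffM m1 m2 f g : (forall n, iter m1 fdiff f n = 0) ->
  (forall n, iter m2 fdiff g n = 0) ->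
  forall n, iter (m1 + m2) fdiff (fun i => f i * g i) n = 0.
Proof.
elim: {m1 m2}(m1 + m2)%N {-2}m1 {-2}m2 (leqnn (m1 + m2)) f g => [|N IH] m1 m2.
  rewrite leqn0 addn_eq0 => /andP[/eqP-> /eqP->] f g f0 _ n /=.
  by have /= -> := f0 n; rewrite mul0r.
case: m1 => [_ f g f0 _ n|m1].
  by apply: iter_fdiff_eq0 => i; have /= -> := f0 i; rewrite mul0r.
case: m2 => [_ f g _ g0 n|m2].
  by apply: iter_fdiff_eq0 => i; have /= -> := g0 i; rewrite mulr0.
rewrite addSn addnS !ltnS => le f g f0 g0 n.
have E : fdiff (fun i => f i * g i) =
    fun i => fdiff f i * g (1 + i)%N + f i * fdiff g i.
  by apply/funext => i; rewrite /fdiff add1n; ring.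
rewrite iterSr E iter_fdiffD -[in X in X + _]addnS -[in X in _ + X]addSn.
rewrite (IH m1 m2.+1)//; last 3 first.
- by rewrite addnS.
- by move=> i; rewrite -iterSr.
- by move=> i; rewrite iter_fdiff_shift.
rewrite (IH m1.+1 m2) ?addr0//.
by move=> i; rewrite -iterSr.
Qed.

Lemma fdiff_nilpotentM f g : fdiff_nilpotent f -> fdiff_nilpotent g ->
  fdiff_nilpotent (fun n => f n * g n).
Proof. by move=> [m1 f0] [m2 g0]; exists (m1 + m2)%N; exact: iter_fdiffM. Qed.

Lemma fdiff_nilpotentD f g : fdiff_nilpotent f -> fdiff_nilpotent g ->
  fdiff_nilpotent (fun n => f n + g n).
Proof.
move=> [m1 f0] [m2 g0]; exists (maxn m1 m2) => n; rewrite iter_fdiffD.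
rewrite (iter_fdiff_le (leq_maxl _ _) f0) (iter_fdiff_le (leq_maxr _ _) g0).
by rewrite addr0.
Qed.

Lemma fdiff_nilpotentZ c f : fdiff_nilpotent f ->
  fdiff_nilpotent (fun n => c * f n).
Proof. by move=> [m f0]; exists m => n; rewrite iter_fdiffZ f0 mulr0. Qed.

Lemma fdiff_nilpotent_sum (I : Type) (r : seq I) (F : I -> nat -> A) :
  (forall i, fdiff_nilpotent (F i)) ->
  fdiff_nilpotent (fun n => \sum_(i <- r) F i n).
Proof.
move=> H; elim: r => [|i r IH].
  by exists 1%N => n; rewrite /= /fdiff !big_nil subrr.
have -> : (fun n => \sum_(j <- i :: r) F j n) =
    fun n => F i n + \sum_(j <- r) F j n.
  by apply/funext => n; rewrite big_cons.
exact: fdiff_nilpotentD.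
Qed.

Lemma fdiff_nilpotent_fdiff f : fdiff_nilpotent (fdiff f) -> fdiff_nilpotent f.
Proof. by move=> [m f0]; exists m.+1 => n; rewrite iterSr. Qed.

Lemma fdiff_nilpotent_bin e : fdiff_nilpotent (fun n => 'C(n, e)%:R : A).
Proof.
elim: e => [|e IH].
  by exists 1%N => n; rewrite /= /fdiff !bin0 subrr.
apply: fdiff_nilpotent_fdiff.
have -> // : fdiff (fun n => 'C(n, e.+1)%:R : A) = fun n => 'C(n, e)%:R.
by apply/funext => i; rewrite /fdiff binS natrD addrAC subrr add0r.
Qed.

End PolynomialSequences.

Definition bin_poly (F : fieldType) (j : nat) : {poly F} :=
  (j`!%:R^-1)%:P * \prod_(l < j) ('X - (l%:R)%:P).

Lemma prod_sub_nat (A : comNzRingType) (j n : nat) :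
  \prod_(l < j) (n%:R - l%:R : A) = (n ^_ j)%:R.
Proof.
elim: j => [|j IH]; first by rewrite big_ord0.
rewrite big_ord_recr/= IH; have [jn|nj] := leqP j n.
  by rewrite ffactnSr natrM natrB.
by rewrite !ffact_small ?mul0r// (leq_trans nj).
Qed.

Lemma horner_bin_poly (F : numFieldType) (j n : nat) :
  (bin_poly F j).[n%:R] = 'C(n, j)%:R.
Proof.
rewrite /bin_poly hornerM hornerC horner_prod.
under eq_bigr do rewrite hornerXsubC.
rewrite prod_sub_nat -bin_ffact natrM mulrC mulfK//.
by rewrite pnatr_eq0 -lt0n fact_gt0.
Qed.

Lemma fdiff_nilpotent_poly (F : numFieldType) (f : nat -> F) :
  fdiff_nilpotent f -> exists Q : {poly F}, forall n, f n = Q.[n%:R].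
Proof.
move=> [m f0]; exists (\sum_(j < m) (iter j fdiff f 0) *: bin_poly F j) => n.
rewrite (newton f0) horner_sum; apply: eq_bigr => j _.
by rewrite hornerZ horner_bin_poly mulr_natr.
Qed.

(** The recursion splits off the largest entry, so that the difference in [k] of a sum over
    [incseqs r.+1 k] is a sum over [incseqs r k]. It is also the recursion of deletion and
    restriction. *)
Fixpoint incseqs (r k : nat) : seq (seq nat) :=
  match r, k with
  | 0, _ => [:: [::]]
  | _.+1, 0 => [::]
  | r'.+1, k'.+1 => incseqs r k' ++ [seq rcons s k' | s <- incseqs r' k']
  end.

Lemma incseqs0 k : incseqs 0 k = [:: [::]].
Proof. by case: k. Qed.

Lemma incseqsS r k :
  incseqs r.+1 k.+1 = incseqs r.+1 k ++ [seq rcons s k | s <- incseqs r k].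
Proof. by []. Qed.

Lemma incseqs_small r k : (k < r)%N -> incseqs r k = [::].
Proof.
elim: k r => [|k IH] [|r]//; rewrite ltnS => kr.
by rewrite incseqsS !IH// ltnW.
Qed.

Lemma incseqs_diag k : incseqs k k = [:: iota 0 k].
Proof.
elim: k => // k IH.
by rewrite incseqsS incseqs_small//= IH/= -cats1 -(iotaD 0 k 1) addn1.
Qed.

Lemma incseqs_spec r k s : s \in incseqs r k ->
  [/\ size s = r, sorted ltn s & all (fun u => (u < k)%N) s].
Proof.
elim: k r s => [|k IH] [|r] s //; first by rewrite incseqs0 inE => /eqP->.
  by rewrite incseqs0 inE => /eqP->.
rewrite incseqsS mem_cat => /orP[/IH[-> -> /allP h]|/mapP[t /IH[st sot /allP h] ->]].
  by split=> //; apply/allP => u /h /ltnW.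
split; first by rewrite size_rcons st.
  case: t sot h {st} => //= a t sot h.
  by rewrite rcons_path sot/=; apply: h; exact: mem_last.
rewrite all_rcons ltnSn; apply/allP => u /h; exact: ltnW.
Qed.

(** One difference in [k] leaves the sum for [r] times [g r k]; induction on [r] and stability under
    products conclude. *)
Lemma fdiff_nilpotent_incseqs (A : comNzRingType) r (g : nat -> nat -> A) :
  (forall i, fdiff_nilpotent (g i)) ->
  fdiff_nilpotent
    (fun k => \sum_(s <- incseqs r k) \prod_(i < r) g i (nth 0%N s i)).
Proof.
move=> gN; elim: r => [|r IH].
  by exists 1%N => n; rewrite /= /fdiff !incseqs0 !big_seq1 subrr.
apply: fdiff_nilpotent_fdiff.
have -> : fdiff (fun k => \sum_(s <- incseqs r.+1 k) \prod_(i < r.+1) g i (nth 0%N s i))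
  = fun k => (\sum_(s <- incseqs r k) \prod_(i < r) g i (nth 0%N s i)) * g r k.
  apply/funext => k; rewrite /fdiff incseqsS big_cat big_map/= addrAC subrr add0r.
  rewrite mulr_suml big_seq [RHS]big_seq; apply: eq_bigr => s /incseqs_spec[ss _ _].
  rewrite big_ord_recr/= nth_rcons ss ltnn eqxx; congr (_ * _).
  by apply: eq_bigr => i _; rewrite nth_rcons ss ltn_ord.
exact: fdiff_nilpotentM.
Qed.

(** By Newton's formula this matrix sends the jet at 0 of a sequence with vanishing [n]-th
    difference to its values at the nodes [s]. *)
Definition binmx (n : nat) (s : seq nat) : 'M[int]_n :=
  \matrix_(i < n, j < n) 'C(nth 0%N s i, j)%:R.

(** Falling factorials are monic, so their coefficient matrix [T] is unitriangular. As [T] times the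
    Vandermonde matrix has entries [i! * 'C(s_j, i)], the determinant is that of Vandermonde divided
    by a product of factorials. *)
Lemma det_binmx_gt0 n s : sorted ltn s -> size s = n -> 0 < \det (binmx n s).
Proof.
move=> ss sn.
pose q (j : nat) : {poly int} := \prod_(l < j) ('X - (l%:R)%:P).
have qmonic j : q j \is monic by exact: monic_prod_XsubC.
have sq j : size (q j) = j.+1 by rewrite size_prod_XsubC /index_enum -enumT size_enum_ord.
pose a : 'rV[int]_n := \row_i (nth 0%N s i)%:R.
pose T : 'M[int]_n := \matrix_(i, j) (q i)`_j.
have detT : \det T = 1.
  rewrite det_trig; last first.
    apply/is_trig_mxP => i j ij; rewrite mxE nth_default// sq.
    by [].
  rewrite big1// => i _; rewrite mxE.
  by move/monicP: (qmonic i); rewrite lead_coefE sq.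
have E : T *m Vandermonde n a = (\matrix_(i < n, j < n) (nth 0%N s j ^_ i)%:R).
  apply/matrixP => i j; rewrite !mxE -prod_sub_nat.
  transitivity ((q i).[(nth 0%N s j)%:R]); last first.
    by rewrite horner_prod; apply: eq_bigr => l _; rewrite hornerXsubC.
  rewrite (@horner_coef_wide _ n); last by rewrite sq.
  by apply: eq_bigr => l _; rewrite !mxE.
have E2 : (\matrix_(i < n, j < n) (nth 0%N s j ^_ i)%:R : 'M[int]_n) =
    diag_mx (\row_i (i`!%:R)) *m (binmx n s)^T.
  apply/matrixP => i j; rewrite mul_diag_mx !mxE -natrM.
  by rewrite mulnC bin_ffact.
have : 0 < \det (T *m Vandermonde n a).
  rewrite det_mulmx detT mul1r det_Vandermonde.
  apply: prodr_gt0 => i _; apply: prodr_gt0 => j ij.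
  rewrite !mxE subr_gt0 ltr_nat.
  by rewrite (sorted_ltn_nth ltn_trans)// ?inE ?sn.
rewrite E E2 det_mulmx det_diag det_tr pmulr_rgt0//.
by apply: prodr_gt0 => i _; rewrite mxE ltr0n fact_gt0.
Qed.

(** Positivity removes the absolute values. In the Leibniz expansion each permutation contributes a
    sum of products of functions of single entries, to which [fdiff_nilpotent_incseqs] applies. *)
Lemma det_incseqs_poly (R : numFieldType) (d m : nat) :
  exists Q : {poly R}, forall k,
  (\sum_(s <- incseqs d k) `|\det (m%:R *: binmx d s)|%N)%:R = Q.[k%:R].
Proof.
have [Q HQ] : exists Q : {poly R}, forall k,
  \sum_(s <- incseqs d k) (\det (m%:R *: binmx d s))%:~R = Q.[k%:R].
  apply: fdiff_nilpotent_poly.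
  (* The factors must be indexed by [nat]: [insub] extends [p], and its default 0 is never met as
     [i < d]. *)
  have -> : (fun k => \sum_(s <- incseqs d k) (\det (m%:R *: binmx d s))%:~R : R) =
     fun k => \sum_(p : 'S_d) ((-1) ^+ p * m%:R ^+ d) *
        \sum_(s <- incseqs d k) \prod_(i < d) 'C(nth 0%N s i,
          if insub (i : nat) is Some j then (p j : nat) else 0%N)%:R.
    apply/funext => k; under [RHS]eq_bigr do rewrite mulr_sumr.
    rewrite exchange_big/=; apply: eq_bigr => s _.
    rewrite detZ rmorphM/= rmorphXn/= rmorph_sum/= mulr_sumr; apply: eq_bigr => p _.
    rewrite rmorphM/= rmorphXn/= rmorphN1 rmorph_prod/= mulrA.
    rewrite [_ * (-1) ^+ _]mulrC natz -pmulrn; congr (_ * _); apply: eq_bigr => i _.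
    by rewrite mxE natz -pmulrn valK.
  apply: fdiff_nilpotent_sum => p; apply: fdiff_nilpotentZ.
  apply: (@fdiff_nilpotent_incseqs _ d (fun i u => 'C(u,
    if insub (i : nat) is Some j then (p (j : 'I_d) : nat) else 0%N)%:R)).
  by move=> i; exact: fdiff_nilpotent_bin.
exists Q => k; rewrite -HQ natr_sum big_seq [RHS]big_seq; apply: eq_bigr => s.
move=> /incseqs_spec[ss so _].
by rewrite natr_absz ger0_norm// detZ mulr_ge0 ?exprn_ge0// ltW// det_binmx_gt0.
Qed.

(** * Counting classes and lattice indices *)

(** Counts the classes of [E] on [X] by a transversal, without forming a quotient. *)
Definition has_classes (T : Type) (X : T -> Prop) (E : T -> T -> Prop)
    (n : nat) : Prop :=
  exists (I : finType) (r : I -> T), [/\ #|I| = n, forall i, X (r i),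
    forall i j, E (r i) (r j) -> i = j & forall x, X x -> exists i, E x (r i)].

Lemma has_classes_transport (T T' : Type) (X : T -> Prop) (E : T -> T -> Prop)
    (X' : T' -> Prop) (E' : T' -> T' -> Prop) (f : T -> T') n :
  (forall x, X x -> X' (f x)) ->
  (forall x', X' x' -> exists2 x, X x & f x = x') ->
  (forall x y, X x -> X y -> E x y <-> E' (f x) (f y)) ->
  has_classes X' E' n -> has_classes X E n.
Proof.
move=> fX fS fE [I [r [cI rX rE rC]]].
have /choice[h hP] : forall i, exists x, X x /\ f x = r i.
  by move=> i; have [x xX xr] := fS _ (rX i); exists x.
exists I, h; split=> // [i|i j|x xX].
- by have [] := hP i.
- have [Xi Ei] := hP i; have [Xj Ej] := hP j.
  by rewrite fE// Ei Ej; exact: rE.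
- have [i ei] := rC _ (fX _ xX); exists i; have [Xi Ei] := hP i.
  by rewrite fE// Ei.
Qed.

(* Classes of the finer relation F that meet Y are counted by n2; the other
   ones form a system of representatives of the coarser relation E. *)
Lemma has_classesD (T : Type) (X Y : T -> Prop) (E F : T -> T -> Prop) n1 n2 :
  (forall x, Y x -> X x) ->
  (forall x y, F x y -> F y x) ->
  (forall x y z, F x y -> F y z -> F x z) ->
  (forall x y, E x y -> E y x) ->
  (forall x y z, E x y -> E y z -> E x z) ->
  (forall x y, F x y -> E x y) ->
  (forall x, X x -> exists z, [/\ X z, E x z & ~ (exists2 y, Y y & F z y)]) ->
  (forall x y, X x -> X y -> ~ (exists2 z, Y z & F x z) ->
     ~ (exists2 z, Y z & F y z) -> E x y -> F x y) ->
  has_classes X E n1 -> has_classes Y F n2 -> has_classes X F (n1 + n2).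
Proof.
move=> YX Fs Ft Es Et FE low lowF [I1 [r1 [c1 X1 E1 C1]]] [I2 [r2 [c2 X2 E2 C2]]].
have /choice[h hP] : forall i, exists z,
    [/\ X z, E (r1 i) z & ~ (exists2 y, Y y & F z y)].
  by move=> i; exact: low.
exists (I1 + I2)%type, (fun i => match i with inl a => h a | inr b => r2 b end).
split.
- by rewrite card_sum c1 c2.
- by case=> [a|b]; [have [] := hP a|exact/YX/X2].
- case=> [a|a] [b|b] e.
  + have [_ ea _] := hP a; have [_ eb _] := hP b; congr inl; apply: E1.
    exact: Et (Et _ _ _ ea (FE _ _ e)) (Es _ _ eb).
  + by have [_ _ []] := hP a; exists (r2 b).
  + by have [_ _ []] := hP b; exists (r2 a) => //; exact: Fs.
  + by congr inr; exact: E2.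
- move=> x Xx; have [[y Yy xy]|nx] := pselect (exists2 y, Y y & F x y).
    have [b yb] := C2 _ Yy; exists (inr b); exact: Ft yb.
  have [a xa] := C1 _ Xx; exists (inl a).
  have [Xa ea na] := hP a; apply: lowF => //; exact: Et ea.
Qed.

Lemma eq_of_dvd_small (a b : nat) (x t : int) :
  (a < `|x|)%N -> (b < `|x|)%N -> a%:Z - b%:Z = x * t -> a = b.
Proof.
case: (t =P 0) => [->|/eqP t0]; first by rewrite mulr0; lia.
have : (`|x| <= `|(x * t : int)%R|)%N by rewrite abszM leq_pmulr// absz_gt0.
by lia.
Qed.

(** The index of the lattice spanned by the columns of [M]. The Smith normal form, with unimodular
    [L] and [U], reduces to a diagonal matrix, whose cosets are represented by a box of residues. *)
Lemma has_classes_lattice n (M : 'M[int]_n) : \det M != 0 ->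
  has_classes (fun _ : 'cV[int]_n => True)
    (fun x y => exists c, x - y = M *m c) `|\det M|%N.
Proof.
move=> detM; have [L uL [U uU [d _ EM]]] := int_Smith_normal_form M.
set D : 'M[int]_n := \matrix_(i, j) _ in EM.
pose e (i : 'I_n) : int := d`_i.
have ED : D = diag_mx (\row_i e i).
  by apply/matrixP => i j; rewrite /D !mxE.
have absu (A : 'M[int]_n) : A \in unitmx -> `|\det A|%N = 1%N.
  by rewrite unitmxE => /orP[]/eqP->.
have detE : `|\det M|%N = (\prod_(i < n) `|e i|)%N.
  rewrite EM !det_mulmx !abszM (absu L)// (absu U)// mul1n muln1 ED det_diag.
  rewrite (big_morph _ abszM (erefl : `|1|%N = 1%N)).
  by apply: eq_bigr => i _; rewrite mxE.
have d0 i : (0 < `|e i|)%N.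
  move: detM; rewrite -absz_gt0 detE; case: (posnP `|e i|%N) => // d0.
  by rewrite (bigD1 i)//= d0 mul0n.
exists {dffun forall i : 'I_n, 'I_(`|e i|)}.
exists (fun f : {dffun forall i : 'I_n, 'I_(`|e i|)} => L *m (\col_i (f i : nat)%:Z)).
split => //.
- rewrite card_dep_ffun foldrE big_map detE big_enum/=.
  by apply: eq_bigr => i _; rewrite card_ord.
- move=> f g [c]; rewrite -mulmxBr EM -!mulmxA => /(congr1 (mulmx (invmx L))).
  rewrite !mulKmx// => E; apply/ffunP => i; apply/val_inj => /=.
  move: (U *m c) E => c' /matrixP/(_ i 0); rewrite ED mul_diag_mx !mxE.
  exact: eq_of_dvd_small (ltn_ord _) (ltn_ord _).
- move=> x _; have [y ->] : exists y, x = L *m y.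
    by exists (invmx L *m x); rewrite mulKVmx.
  have en0 i : e i != 0 by rewrite -absz_gt0.
  have f_lt i : (`|(y i ord0 %% e i)%Z|%N < `|e i|)%N.
    by have := ltz_mod (y i ord0) (en0 i); have := modz_ge0 (y i ord0) (en0 i); lia.
  have [f fE] : exists f : {dffun forall i : 'I_n, 'I_(`|e i|)},
      forall i, (f i : nat)%:Z = (y i ord0 %% e i)%Z.
    exists (finfun (fun i => Ordinal (f_lt i))) => i; rewrite ffunE/=.
    by rewrite gez0_abs// modz_ge0.
  exists f, (invmx U *m \col_i (y i ord0 %/ e i)%Z).
  rewrite EM -!mulmxA mulKVmx// ED -mulmxBr; congr (_ *m _).
  apply/matrixP => i j; rewrite ord1 mul_diag_mx !mxE fE.
  by rewrite [X in X - _](divz_eq (y i ord0) (e i)) addrK mulrC.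
Qed.

(** * Interpolation *)

Section Interpolation.
Variable R : realType.
Implicit Types (d k : nat) (U : seq nat).

Lemma binmx_unit d U : sorted ltn U -> size U = d ->
  map_mx intr (binmx d U) \in @unitmx R d.
Proof.
move=> sU dU; rewrite unitmxE det_map_mx unitfE intr_eq0.
by rewrite gt_eqF// det_binmx_gt0.
Qed.

(** The morphism [V] makes this usable both for integer sequences (identity) and for real ones
    ([intr]). *)
Lemma newton_binmx (A : comNzRingType) (V : {rmorphism int -> A}) d U (f : nat -> A) :
  (forall n, iter d fdiff f n = 0) ->
  \col_(i < d) f (nth 0%N U i) =
    map_mx V (binmx d U) *m \col_j iter j fdiff f 0.
Proof.
move=> f0; apply/matrixP => i j; rewrite ord1 !mxE (newton f0).
by apply: eq_bigr => l _; rewrite !mxE rmorph_nat mulr_natl.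
Qed.

(** At arbitrary nodes interpolation inverts [binmx] over [R]. The sequence [b] is a particular
    solution of [D^d b = beta], and [f] corrects its values at the nodes. *)
Lemma fdiff_interp d U (beta : R) (v : nat -> R) :
  sorted ltn U -> size U = d -> exists2 g : nat -> R,
  forall n, iter d fdiff g n = beta & forall u, u \in U -> g u = v u.
Proof.
move=> sU dU; have uB := binmx_unit sU dU.
have [b b0 bd] := fdiff_jet_ex d.+1 (fun j => if j == d then beta else 0).
have bbeta n : iter d fdiff b n = beta.
  elim: n => [|n IH]; first by rewrite bd// eqxx.
  by have := b0 n; rewrite iter_fdiffS IH => /eqP; rewrite subr_eq0 => /eqP.
pose w : 'cV[R]_d := invmx (map_mx intr (binmx d U)) *m
  \col_i (v (nth 0%N U i) - b (nth 0%N U i)).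
have [f f0 fj] := fdiff_jet_ex d (fun j => if insub j is Some i then w i 0 else 0).
exists (fun n => b n + f n) => [n|u uU]; first by rewrite iter_fdiffD bbeta f0 addr0.
have uS : (index u U < d)%N by rewrite -dU index_mem.
have := newton_binmx (intr : {rmorphism int -> R}) U f0.
have -> : (\col_(j < d) iter j fdiff f 0) = w.
  by apply/matrixP => i j; rewrite ord1 mxE fj// valK.
rewrite mulKVmx// => /matrixP/(_ (Ordinal uS) 0); rewrite !mxE/= nth_index// => ->.
by rewrite addrC subrK.
Qed.

Lemma fdiff_eval d U k : sorted ltn U -> size U = d -> exists w : 'I_d -> R,
  forall f, (forall n, iter d fdiff f n = 0) ->
    f k = \sum_i w i * f (nth 0%N U i).
Proof.
move=> sU dU; have uB := binmx_unit sU dU.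
have [w wE] : exists w : 'rV[R]_d,
    w *m map_mx intr (binmx d U) = \row_j 'C(k, j)%:R.
  by exists ((\row_j 'C(k, j)%:R) *m invmx (map_mx intr (binmx d U))); rewrite mulmxKV.
exists (w 0) => f f0.
have E := newton_binmx (intr : {rmorphism int -> R}) U f0.
have -> : \sum_i w 0 i * f (nth 0%N U i) = (w *m \col_(i < d) f (nth 0%N U i)) 0 0.
  by rewrite mxE; apply: eq_bigr => i _; rewrite mxE.
rewrite E mulmxA wE mxE (newton f0).
by apply: eq_bigr => l _; rewrite !mxE mulr_natl.
Qed.

Lemma irrationalMz (a : R) (c n : int) :
  irrational a -> c != 0 -> c%:~R * a <> n%:~R.
Proof.
move=> ia c0 E; apply: ia; exists (n%:~R / c%:~R); first by [].
rewrite fmorph_div/= !ratr_int -E mulrAC divff ?mul1r//.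
by rewrite intr_eq0.
Qed.

(** General position. If [g] were an integer at [d + 1] nodes, multiplying Newton's formula by the
    integer adjugate of [binmx] would make a nonzero integer multiple of [beta] an integer. *)
Lemma not_int_on_nodes d U (beta : R) (g : nat -> R) : irrational beta ->
  sorted ltn U -> (forall n, iter d fdiff g n = beta) ->
  (forall u, u \in U -> g u \is a Num.int) -> (size U <= d)%N.
Proof.
move=> ib sU gb gU; rewrite leqNgt; apply/negP => dU.
pose W := take d.+1 U.
have sW : sorted ltn W by exact: take_sorted.
have dW : size W = d.+1 by rewrite size_takel.
have g0 n : iter d.+1 fdiff g n = 0 by rewrite iter_fdiffS !gb subrr.
have E := newton_binmx (intr : {rmorphism int -> R}) W g0.
have detW := det_binmx_gt0 sW dW.
set c := \col_j iter j fdiff g 0 in E.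
have EG : \col_(i < d.+1) g (nth 0%N W i) =
    map_mx intr (\col_(i < d.+1) Num.floor (g (nth 0%N W i))).
  apply/matrixP => i j; rewrite !mxE floorK// gU//.
  by apply: (@mem_take d.+1); rewrite -/W mem_nth// dW.
move/(congr1 (mulmx (map_mx intr (\adj (binmx d.+1 W))))): E.
(* The last entry of the jet is [iter d fdiff g 0], that is, [beta]. *)
rewrite EG mulmxA -!map_mxM mul_adj_mx => /matrixP/(_ ord_max 0).
rewrite map_scalar_mx mul_scalar_mx [in RHS]mxE [in LHS]mxE [in RHS]mxE /= gb.
by move=> /esym; apply: irrationalMz => //; rewrite gt_eqF.
Qed.

End Interpolation.

(** * Counting the cells *)

Section CountCells.
Variables (R : realType) (d m : nat) (beta : R).
Implicit Types (g h : nat -> R) (z : nat -> int) (U S : seq nat).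

(** The intersection of the walls indexed by [S]; for [S = [::]], the whole affine space. *)
Definition int_at S g : Prop := (forall n, iter d fdiff g n = beta) /\
  (forall u, u \in S -> g u \is a Num.int).

(** Lying in the same cell of the torus for the walls indexed by [U], the lattice acting by [m * z].
    Reading cells off floors makes them half-open. *)
Definition cell_eq U g h : Prop := exists2 z : nat -> int,
  (forall n, iter d fdiff z n = 0) &
  forall u, u \in U -> Num.floor (g u) = Num.floor (h u) + m%:Z * z u.

Lemma cell_eq_sym U g h : cell_eq U g h -> cell_eq U h g.
Proof.
move=> [z z0 zE]; exists (fun n => - z n) => [n|u uU].
  by rewrite iter_fdiffN z0 oppr0.
by rewrite zE// mulrN addrK.
Qed.

Lemma cell_eq_trans U g h l : cell_eq U g h -> cell_eq U h l -> cell_eq U g l.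
Proof.
move=> [z z0 zE] [y y0 yE]; exists (fun n => y n + z n) => [n|u uU].
  by rewrite iter_fdiffD z0 y0 addr0.
by rewrite zE// yE// mulrDr addrA.
Qed.

Lemma cell_eq_sub U V g h : {subset U <= V} -> cell_eq V g h -> cell_eq U g h.
Proof. by move=> UV [z z0 zE]; exists z => // u /UV; exact: zE. Qed.

Lemma cell_eq_floor U g h :
  (forall u, u \in U -> Num.floor (g u) = Num.floor (h u)) -> cell_eq U g h.
Proof.
move=> E; exists (fun=> 0) => [n|u uU]; first exact: iter_fdiff0.
by rewrite mulr0 addr0 E.
Qed.

Lemma int_at_translate S g z : (forall n, iter d fdiff z n = 0) -> int_at S g ->
  int_at S (fun n => g n + (m%:Z * z n)%:~R).
Proof.
move=> z0 [gb gS]; split=> [n|u uS]; last by rewrite rpredD ?gS ?intr_int.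
rewrite iter_fdiffD gb.
suff -> : iter d fdiff (fun i => (m%:Z * z i)%:~R : R) n = 0 by rewrite addr0.
have E l i : iter l fdiff (fun i => (m%:Z * z i)%:~R : R) i =
    (m%:Z * iter l fdiff z i)%:~R.
  elim: l i => // l IH i; rewrite !iter_fdiffS !IH.
  by rewrite mulrBr rmorphB.
by rewrite E z0 mulr0.
Qed.

Lemma cell_eq_representative S U g h : int_at S h -> cell_eq U g h ->
  exists l, [/\ int_at S l, forall V, cell_eq V l h &
    forall u, u \in U -> Num.floor (l u) = Num.floor (g u)].
Proof.
move=> hS [z z0 zE]; exists (fun n => h n + (m%:Z * z n)%:~R); split.
- exact: int_at_translate.
- by move=> V; exists z => // u _; rewrite floorDrz ?intr_int// intrKfloor.
- by move=> u uU; rewrite floorDrz ?intr_int// intrKfloor zE.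
Qed.

Lemma int_floor_inj (x y : R) : x \is a Num.int -> y \is a Num.int ->
  Num.floor x = Num.floor y -> x = y.
Proof. by move=> /floorK {2}<- /floorK {2}<- ->. Qed.

(** Equal floors bound [g - h] by 1 at [d] nodes of [U], and [g k - h k] is a fixed linear
    combination of its values there. So each cell has a lowest slab. *)
Lemma cell_bounded S U k g : {subset S <= U} -> sorted ltn U -> (d <= size U)%N ->
  int_at S g -> exists B : int, forall h, int_at S h ->
    (forall u, u \in U -> Num.floor (h u) = Num.floor (g u)) ->
    B <= Num.floor (h k).
Proof.
move=> SU sU dU [gb _].
have [w wE] := fdiff_eval R k (take_sorted d sU) (size_takel dU).
exists (Num.floor (g k - \sum_i `|w i|)) => h [hb _] hg; apply: le_floor.
have f0 n : iter d fdiff (fun i => g i - h i) n = 0.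
  by rewrite iter_fdiffB gb hb subrr.
rewrite lerBlDl -lerBlDr; have /= -> := wE _ f0; apply: ler_sum => i _.
apply: le_trans (ler_norm _) _; rewrite normrM ler_piMr//.
set u := nth _ _ _; have uU : u \in U.
  by apply: (@mem_take d); rewrite mem_nth// size_takel.
have := floor_itv (g u); have := floor_itv (h u); rewrite hg// !intrD.
by move=> /andP[? ?] /andP[? ?]; rewrite ler_norml; apply/andP; split; lra.
Qed.

Lemma common_eps (s : seq nat) (P : nat -> R -> Prop) :
  (forall u, u \in s -> exists2 e0, 0 < e0 & forall e, 0 < e <= e0 -> P u e) ->
  exists2 e0, 0 < e0 & forall u e, u \in s -> 0 < e <= e0 -> P u e.
Proof.
elim: s => [|v s IH] H; first by exists 1.
have [|e1 e10 H1] := IH; first by move=> u us; apply: H; rewrite inE us orbT.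
have [e2 e20 H2] := H v (mem_head _ _).
exists (Num.min e1 e2) => [|u e]; first by rewrite lt_min e10.
rewrite inE le_min => /orP[/eqP->|us] /and3P[e0 h1 h2]; first by apply: H2; rewrite e0.
by apply: H1; rewrite ?e0.
Qed.

Lemma floor_perturb (x y : R) : x \isn't a Num.int ->
  exists2 e0, 0 < e0 & forall e, 0 < e <= e0 -> Num.floor (x - e * y) = Num.floor x.
Proof.
move=> xN; have /andP[x1 x2] := floor_itv x.
have x1' : (Num.floor x)%:~R < x.
  rewrite lt_neqAle x1 andbT; apply/negP => /eqP E; move: xN.
  by rewrite intrEfloor E eqxx.
set a := x - (Num.floor x)%:~R; set b := (Num.floor x + 1)%:~R - x.
have a0 : 0 < a by rewrite subr_gt0.
have b0 : 0 < b by rewrite subr_gt0.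
have y0 : 0 < `|y| + 1 by rewrite ltr_wpDl.
exists (Num.min a b / (`|y| + 1) / 2) => [|e].
  by rewrite !divr_gt0// lt_min a0.
move=> /andP[e0 he]; apply: floor_def.
have : e * `|y| < Num.min a b.
  apply: (@le_lt_trans _ _ (Num.min a b / 2)).
    apply: le_trans (_ : e * (`|y| + 1) <= _).
      by rewrite ler_wpM2l ?ltW// ltrDl.
    by rewrite mulrAC ler_pdivlMr in he.
  have : 0 < Num.min a b by rewrite lt_min a0.
  by move: (Num.min a b) => c c0; lra.
rewrite lt_min => /andP[ha hb].
have : `|e * y| = e * `|y| by rewrite normrM gtr0_norm.
have := ler_norm (e * y); have := ler_norm (- (e * y)); rewrite normrN.
by move=> h1 h2 h3; rewrite /a /b in ha hb; apply/andP; split; lra.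
Qed.

Hypothesis beta_irrational : irrational beta.

(** By general position the set [N] of the other nodes that must be kept at integer values has fewer
    than [d] elements, so a polynomial [l] of degree below [d] vanishes on [N] and is 1 at [k].
    Subtracting a small multiple of [l] lowers the floor at [k] and keeps the others. *)
Lemma floor_decrease S k h : sorted ltn (k :: S) -> int_at (k :: S) h ->
  exists l, [/\ int_at S l,
    forall u, u \in iota 0 k ++ S -> Num.floor (l u) = Num.floor (h u) &
    Num.floor (l k) < Num.floor (h k)].
Proof.
move=> skS [hb hkS].
pose I := [seq i <- iota 0 k | h i \is a Num.int]; pose N := I ++ S.
have kN : k \notin N.
  rewrite mem_cat mem_filter mem_iota ltnn !andbF /=.
  apply/negP => kS; move: skS; rewrite /= => /(order_path_min ltn_trans) /allP/(_ _ kS).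
  by rewrite ltnn.
have szN : (size N < d)%N.
  have : (size (I ++ k :: S) <= d)%N.
    apply: (not_int_on_nodes beta_irrational _ hb).
      rewrite (sorted_pairwise ltn_trans) pairwise_cat -!(sorted_pairwise ltn_trans) skS.
      rewrite (sorted_filter ltn_trans) ?iota_ltn_sorted// !andbT.
      apply/allrelP => i j; rewrite mem_filter mem_iota => /andP[_ /andP[_ ik]].
      rewrite inE => /orP[/eqP->//|jS]; apply: ltn_trans ik _.
      by move: skS; rewrite /= => /(order_path_min ltn_trans) /allP/(_ _ jS).
    move=> u; rewrite mem_cat mem_filter => /orP[/andP[]//|]; exact: hkS.
  by rewrite /N !size_cat/= addnS.
pose p n : R := \prod_(s <- N) (n%:R - s%:R).
have pk : p k != 0.
  rewrite /p prodf_seq_neq0; apply/allP => s sN; rewrite /= subr_eq0 eqr_nat.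
  by apply: contraNneq kN => ->.
pose l n := (p k)^-1 * p n.
have lN u : u \in N -> l u = 0.
  move=> uN; apply/eqP; rewrite mulf_eq0 /p prodf_seq_eq0; apply/orP; right.
  by apply/hasP; exists u => //=; rewrite subrr.
have l0 n : iter d fdiff l n = 0.
  rewrite iter_fdiffZ (iter_fdiff_le szN) ?mulr0// => i.
  exact: iter_fdiff_prod_linear.
(* Only nodes with a non-integer value constrain [e]; the [eq_ind] term extracts non-integrality
   from membership in the filtered list. *)
have [e0 e00 He] := common_eps (s := [seq i <- iota 0 k | h i \isn't a Num.int])
  (P := fun u e => Num.floor (h u - e * l u) = Num.floor (h u)) (fun u uI =>
   floor_perturb (l u) (proj1 (andP (eq_ind _ is_true uI _ (mem_filter _ _ _))))).
pose e := Num.min e0 1.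
have ee0 : 0 < e <= e0 by rewrite /e lt_min e00 ltr01 ge_min lexx.
have fN u : u \in N -> h u - e * l u = h u.
  by move=> uN; rewrite lN// mulr0 subr0.
exists (fun n => h n - e * l n); split.
- split=> [n|u uS]; first by rewrite iter_fdiffB hb iter_fdiffZ l0 mulr0 subr0.
  by rewrite fN ?hkS ?inE ?uS ?orbT// mem_cat uS orbT.
- move=> u; rewrite mem_cat => /orP[uk|uS]; last by rewrite fN// mem_cat uS orbT.
  case: (boolP (h u \is a Num.int)) => hu; last by apply: He => //; rewrite mem_filter hu.
  by rewrite fN// mem_cat mem_filter hu uk.
- rewrite floor_lt_int floorK; last by apply: hkS; rewrite inE eqxx.
  rewrite /l mulVf// mulr1 ltrBlDr ltrDl.
  by case/andP: ee0.
Qed.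

(** Floor conditions are convex: the point of the segment from [g] to [h] where the value at [k]
    reaches the floor of [h k] is on the wall and keeps the floors of [h]. *)
Lemma cell_crosses S U k g h : int_at S g -> int_at S h ->
  (forall u, u \in U -> Num.floor (g u) = Num.floor (h u)) ->
  {subset S <= U} -> Num.floor (g k) < Num.floor (h k) ->
  exists2 l, int_at (k :: S) l &
    forall u, u \in k :: U -> Num.floor (l u) = Num.floor (h u).
Proof.
move=> [gb gS] [hb hS] gh SU; rewrite floor_lt_int => lt_gk.
have hk := floor_le (h k).
pose t := ((Num.floor (h k))%:~R - g k) / (h k - g k).
have hg0 : 0 < h k - g k by rewrite subr_gt0 (lt_le_trans lt_gk).
have t0 : 0 < t by rewrite divr_gt0// subr_gt0.
have t1 : t <= 1 by rewrite ler_pdivrMr// mul1r lerB.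
pose l n := g n + t * (h n - g n).
have lk : l k = (Num.floor (h k))%:~R.
  by rewrite /l /t divfK ?gt_eqF// addrC subrK.
have lS u : u \in S -> l u = h u.
  move=> uS.
  by rewrite /l (int_floor_inj (gS u uS) (hS u uS) (gh _ (SU _ uS))) subrr mulr0 addr0.
exists l; first split => [n|u].
- by rewrite iter_fdiffD iter_fdiffZ iter_fdiffB hb gb subrr mulr0 addr0.
- by rewrite inE => /orP[/eqP->|uS]; rewrite ?lk// lS// hS.
- move=> u; rewrite inE => /orP[/eqP->|uU]; first by rewrite lk intrKfloor.
  apply: floor_def; have := floor_itv (h u); have := floor_itv (g u); rewrite gh//.
  move: (_%:~R) (_%:~R) => a b /andP[? ?] /andP[? ?]; rewrite /l.
  apply/andP; split; nra.
Qed.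

(* A cell of the U-arrangement is cut by the walls {g k is an integer} into
   slabs; every slab but the lowest one contains a point of such a wall. *)
Lemma has_classes_step S k n1 n2 : sorted ltn (k :: S) -> (d <= k + size S)%N ->
  has_classes (int_at S) (cell_eq (iota 0 k ++ S)) n1 ->
  has_classes (int_at (k :: S)) (cell_eq (iota 0 k ++ k :: S)) n2 ->
  has_classes (int_at S) (cell_eq (iota 0 k ++ k :: S)) (n1 + n2).
Proof.
move=> skS dkS; set U := iota 0 k ++ S; set V := iota 0 k ++ k :: S.
have UV : {subset U <= V}.
  by move=> u; rewrite !mem_cat inE => /orP[->//|->]; rewrite !orbT.
have SU : {subset S <= U} by move=> u uS; rewrite mem_cat uS orbT.
have VkU : {subset V <= k :: U}.
  by move=> u; rewrite inE !mem_cat inE orbCA.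
have kV : k \in V by rewrite mem_cat inE eqxx orbT.
have sU : sorted ltn U.
  rewrite (sorted_pairwise ltn_trans) pairwise_cat -!(sorted_pairwise ltn_trans).
  rewrite iota_ltn_sorted (path_sorted skS) !andbT.
  apply/allrelP => i j; rewrite mem_iota => /andP[_ ik] jS; apply: ltn_trans ik _.
  by move: skS; rewrite /= => /(order_path_min ltn_trans) /allP/(_ _ jS).
have dU : (d <= size U)%N by rewrite size_cat size_iota.
apply: has_classesD.
- by move=> g [gb gS]; split=> // u uS; apply: gS; rewrite inE uS orbT.
- exact: cell_eq_sym.
- exact: cell_eq_trans.
- exact: cell_eq_sym.
- exact: cell_eq_trans.
- by move=> g h; exact: cell_eq_sub.
(* Existence of a lowest slab: as long as the slab of [h] meets the wall, [floor_decrease] leads to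
   a lower one, and the bound [B] stops the descent. *)
- move=> g gS; have [B HB] := cell_bounded k SU sU dU gS.
  suff H (N : nat) h : int_at S h ->
      (forall u, u \in U -> Num.floor (h u) = Num.floor (g u)) ->
      Num.floor (h k) <= B + N%:Z ->
      exists h', [/\ int_at S h', cell_eq U g h' &
        ~ (exists2 y, int_at (k :: S) y & cell_eq V h' y)].
    by apply: (H `|Num.floor (g k) - B|%N g) => //; lia.
  elim: N h => [|N IH] h hS hg hB.
    have [[y yS hy]|nh] := pselect (exists2 y, int_at (k :: S) y & cell_eq V h y).
      have [y' [y'S _ y'h]] := cell_eq_representative yS hy.
      have [l [lS ly lk]] := floor_decrease skS y'S.
      have lg u : u \in U -> Num.floor (l u) = Num.floor (g u).
        by move=> uU; rewrite ly// y'h ?hg//; exact: UV.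
      by have := HB l lS lg; rewrite y'h// in lk; lia.
    by exists h; split=> //; apply: cell_eq_floor => u uU; rewrite hg.
  have [[y yS hy]|nh] := pselect (exists2 y, int_at (k :: S) y & cell_eq V h y); last first.
    by exists h; split=> //; apply: cell_eq_floor => u uU; rewrite hg.
  have [y' [y'S _ y'h]] := cell_eq_representative yS hy.
  have [l [lS ly lk]] := floor_decrease skS y'S.
  apply: (IH l) => //; first by move=> u uU; rewrite ly// y'h ?hg//; exact: UV.
  by move: lk; rewrite y'h//; lia.
(* Uniqueness: of two slabs of one cell, the higher contains a wall point by [cell_crosses]. *)
- move=> g h gS hS ng nh gh.
  have [l [lS lh lg]] := cell_eq_representative hS gh.
  have nl : ~ (exists2 y, int_at (k :: S) y & cell_eq V l y).
    move=> [y yS ly]; apply: nh; exists y => //.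
    by apply: cell_eq_trans ly; apply: cell_eq_sym.
  suff E : Num.floor (g k) = Num.floor (l k).
    apply: cell_eq_trans (lh V); apply: cell_eq_floor => u /VkU.
    by rewrite inE => /orP[/eqP->//|uU]; rewrite lg.
  case: (ltgtP (Num.floor (g k)) (Num.floor (l k))) => // lt.
  + have [c cS cl] := cell_crosses gS lS (fun u uU => esym (lg u uU)) SU lt.
    by case: nl; exists c => //; apply: cell_eq_floor => u /VkU /cl.
  + have [c cS cl] := cell_crosses lS gS lg SU lt.
    by case: ng; exists c => //; apply: cell_eq_floor => u /VkU /cl.
Qed.

(** With exactly [d] nodes the values on [U] are free coordinates, so cells are vectors of floors
    modulo the columns of [m * binmx]. Interpolating the floors themselves gives a representative on
    all the walls at once, so the count does not depend on [S]. *)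
Lemma has_classes_base U : sorted ltn U -> size U = d -> (0 < m)%N ->
  forall S, {subset S <= U} ->
  has_classes (int_at S) (cell_eq U) `|\det (m%:R *: binmx d U)|%N.
Proof.
move=> sU dU m0 S SU.
have detn0 : \det (m%:R *: binmx d U) != 0.
  rewrite detZ mulf_neq0// ?expf_neq0 ?pnatr_eq0 -?lt0n//.
  by rewrite gt_eqF// det_binmx_gt0.
apply: (has_classes_transport (f := fun g => \col_i Num.floor (g (nth 0%N U i))))
  (has_classes_lattice detn0) => //.
- move=> v _; have [g gb gv] := fdiff_interp beta
    (fun u => (if insub (index u U) is Some i then v i 0 else 0)%:~R) sU dU.
  exists g; first split=> // u /SU uU; first by rewrite gv.
  apply/matrixP => i j; rewrite ord1 !mxE gv ?mem_nth ?dU//.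
  rewrite index_uniq ?dU// ?valK ?intrKfloor//.
  exact: sorted_uniq ltn_trans ltnn _ sU.
- move=> g h _ _; split.
  + move=> [z z0 zE]; exists (\col_j iter j fdiff z 0).
    have := newton_binmx (idfun : {rmorphism int -> int}) U z0.
    rewrite map_mx_id// => E; rewrite -scalemxAl -E.
    apply/matrixP => i j; rewrite !mxE zE ?mem_nth ?dU//.
    by rewrite addrC addKr natz.
  + move=> [c cE]; have [z z0 zj] := fdiff_jet_ex d
      (fun j => if insub j is Some i then c i 0 else 0).
    exists z => // u uU.
    have uS : (index u U < d)%N by rewrite -dU index_mem.
    have := newton_binmx (idfun : {rmorphism int -> int}) U z0.
    rewrite map_mx_id//; have -> : (\col_(j < d) iter j fdiff z 0) = c.
      by apply/matrixP => i j; rewrite ord1 mxE zj// valK.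
    move=> E; move: cE; rewrite -scalemxAl -E => /matrixP/(_ (Ordinal uS) 0).
    by rewrite !mxE/= nth_index// natz => /eqP; rewrite subr_eq addrC => /eqP.
Qed.

(** Deletion and restriction on the highest remaining wall: deletion keeps [S], restriction adds the
    wall to it. Thus [S] holds the largest entries, already chosen, of the vertices [s ++ S]. *)
Lemma count_cells k S : (0 < m)%N -> sorted ltn S -> all (leq k) S ->
  (d <= k + size S)%N -> (size S <= d)%N ->
  has_classes (int_at S) (cell_eq (iota 0 k ++ S))
    (\sum_(s <- incseqs (d - size S) k) `|\det (m%:R *: binmx d (s ++ S))|)%N.
Proof.
move=> m0; elim: k S => [|k IH] S sS kS dkS Sd.
  have ES : size S = d by apply/eqP; rewrite eqn_leq Sd.
  rewrite ES subnn incseqs0 big_seq1 /=.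
  exact: has_classes_base.
have sU : sorted ltn (iota 0 k.+1 ++ S).
  rewrite (sorted_pairwise ltn_trans) pairwise_cat -!(sorted_pairwise ltn_trans).
  rewrite iota_ltn_sorted sS !andbT.
  apply/allrelP => i j; rewrite mem_iota => /andP[_ ik] jS; apply: leq_trans ik _.
  by move/allP: kS => /(_ _ jS).
(* When only [d] nodes are left none can be deleted, and [incseqs] lists a single vertex. *)
have [dE|dlt] := eqVneq d (k.+1 + size S)%N.
  rewrite [in incseqs _ _]dE addnK incseqs_diag big_seq1.
  apply: has_classes_base => //; first by rewrite size_cat size_iota.
  by move=> u uS; rewrite mem_cat uS orbT.
have dkS' : (d <= k + size S)%N by move: dkS dlt; lia.
have EV : iota 0 k.+1 ++ S = iota 0 k ++ k :: S.
  by rewrite -addn1 iotaD -catA.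
have skS : sorted ltn (k :: S).
  by rewrite /= path_sortedE ?sS ?andbT//; exact: ltn_trans.
have H1 := IH S sS (sub_all (fun u (h : (k < u)%N) => ltnW h) kS) dkS' Sd.
(* When [S] has [d] elements, the restriction to the wall [k] is empty by general position. *)
rewrite EV; have [ES|nS] := eqVneq (size S) d.
  rewrite ES subnn !incseqs0 in H1 *; rewrite -[X in has_classes _ _ X]addn0.
  apply: has_classes_step => //.
  exists void, (fun v : void => match v with end); split=> [|[]|[]|g [gb gS]].
    by rewrite card_void.
  have := not_int_on_nodes beta_irrational skS gb gS.
  by rewrite /= ES ltnn.
have Slt : (size S < d)%N by rewrite ltn_neqAle nS.
have H2 := IH (k :: S) skS; rewrite /= leqnn addnS in H2.
have {}H2 := H2 (sub_all (fun u (h : (k < u)%N) => ltnW h) kS)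
  (leq_trans dkS' (leqnSn _)) Slt.
have := has_classes_step skS dkS' H1 H2.
have -> : (d - size S)%N = (d - (size S).+1).+1 by rewrite subnSK.
rewrite incseqsS big_cat/= big_map.
by under [in X in _ -> has_classes _ _ (_ + X)]eq_bigr do rewrite cat_rcons.
Qed.

End CountCells.

(** * Weyl's theorem *)

Section Weyl.
Variable R : realType.
Implicit Types (x y a : R) (p : nat -> R).

(** With [esin], the real and imaginary parts of [e(x) = exp(2 pi i x)]. *)
Definition ecos x : R := cos (pi *+ 2 * x).
Definition esin x : R := sin (pi *+ 2 * x).

Lemma ecosD x y : ecos (x + y) = ecos x * ecos y - esin x * esin y.
Proof. by rewrite /ecos mulrDr cosD. Qed.

Lemma esinD x y : esin (x + y) = esin x * ecos y + ecos x * esin y.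
Proof. by rewrite /esin mulrDr sinD. Qed.

Lemma ecosN x : ecos (- x) = ecos x.
Proof. by rewrite /ecos mulrN cosN. Qed.

Lemma esinN x : esin (- x) = - esin x.
Proof. by rewrite /esin mulrN sinN. Qed.

Lemma ecos0 : ecos 0 = 1.
Proof. by rewrite /ecos mulr0 cos0. Qed.

Lemma ecos_sqr x : ecos x ^+ 2 + esin x ^+ 2 = 1.
Proof. exact: cos2Dsin2. Qed.

Lemma ecos_max x : `|ecos x| <= 1.
Proof. exact: cos_max. Qed.

Lemma ecosDz x (z : int) : ecos (x + z%:~R) = ecos x.
Proof.
have ecosDn y (n : nat) : ecos (y + n%:R) = ecos y.
  by rewrite /ecos mulrDr mulr_natr (periodicn (@cosD2pi R)).
case: z => n; first exact: ecosDn.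
by rewrite NegzE -[LHS](ecosDn _ n.+1) mulrNz subrK.
Qed.

(** The denominator in [weyl1] does not vanish: otherwise the fractional part [y] of [a], with
    [0 < y < 1], would satisfy [sin (pi y) = 0]. *)
Lemma esin_half_neq0 a : irrational a -> esin (a / 2) != 0.
Proof.
move=> ia; apply/eqP => sa0; have /andP[y0 y1] := floor_itv a.
set z := Num.floor a in y0 y1; pose y := a - z%:~R.
have yn0 : y != 0.
  apply/eqP => /eqP; rewrite subr_eq0 => /eqP az; apply: ia.
  by exists (z%:~R) => //; rewrite ratr_int.
have dbl x : ecos x = 1 - 2 * esin (x / 2) ^+ 2.
  rewrite [in LHS](_ : x = x / 2 + x / 2) ?ecosD -?splitr//.
  by have := ecos_sqr (x / 2); rewrite !expr2; lra.
have : ecos y = 1 - 0 by rewrite -(ecosDz y z) subrK dbl sa0 expr0n mulr0.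
rewrite dbl => /addrI /oppr_inj /eqP; rewrite mulf_eq0 pnatr_eq0/= sqrf_eq0.
rewrite gt_eqF// /esin (_ : pi *+ 2 * (y / 2) = pi * y); last by rewrite mulr2n; field.
have y0' : 0 < y by rewrite lt_neqAle eq_sym yn0 subr_ge0.
apply: sin_gt0_pi; rewrite mulr_gt0 ?pi_gt0//= gtr_pMr ?pi_gt0//.
by rewrite ltrBlDr addrC -[X in _ + X]/(1%:~R) -intrD.
Qed.

Lemma nat_large x : exists K : nat, forall k : nat, (K <= k)%N -> x <= k%:R.
Proof.
exists (Num.bound `|x|) => k; rewrite -(ler_nat R); apply: le_trans.
by apply: le_trans (ler_norm _) _; apply: ltW; exact: archi_boundP.
Qed.

Lemma common_bound (I : finType) (P : I -> nat -> Prop) :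
  (forall i, exists K : nat, forall k, (K <= k)%N -> P i k) ->
  exists K : nat, forall k, (K <= k)%N -> forall i, P i k.
Proof.
move=> /choice[K HK]; exists (\max_i K i)%N => k Kk i; apply: HK.
exact: leq_trans (leq_bigmax i) Kk.
Qed.

(** The squared modulus of the sum of the [e(theta i)] is a nonnegative weight, and its product with
    a cosine is again a sum of cosines, to which Weyl's theorem applies term by term. *)
Lemma fejer (I : finType) (theta : I -> R) y :
  ((\sum_i ecos (theta i)) ^+ 2 + (\sum_i esin (theta i)) ^+ 2) * ecos y =
  \sum_i \sum_j ecos (theta i - theta j + y).
Proof.
set C := \sum_i ecos _; set S := \sum_i esin _.
have E i : \sum_j ecos (theta i - theta j + y) =
    ecos (theta i) * (C * ecos y + S * esin y) +
    esin (theta i) * (S * ecos y - C * esin y).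
  rewrite /C /S !mulr_suml -big_split/= -sumrB !mulr_sumr -big_split/=.
  apply: eq_bigr => j _; rewrite !ecosD esinD ecosN esinN; ring.
under eq_bigr do rewrite E.
rewrite big_split/= -!mulr_suml -/C -/S; ring.
Qed.

Lemma fejer0 (I : finType) (theta : I -> R) :
  (\sum_i ecos (theta i)) ^+ 2 + (\sum_i esin (theta i)) ^+ 2 =
  \sum_i \sum_j ecos (theta i - theta j).
Proof.
rewrite -[LHS]mulr1 -ecos0 fejer.
by apply: eq_bigr => i _; apply: eq_bigr => j _; rewrite addr0.
Qed.

Lemma sum_const_ord n x : \sum_(i < n) x = n%:R * x.
Proof. by rewrite sumr_const card_ord mulr_natl. Qed.

Lemma sqr_sum_le (k : nat) (f : nat -> R) :
  (\sum_(i < k) f i) ^+ 2 <= k%:R * \sum_(i < k) f i ^+ 2.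
Proof.
have -> : k%:R * \sum_(i < k) f i ^+ 2 =
    \sum_(i < k) \sum_(j < k) (f i ^+ 2 / 2 + f j ^+ 2 / 2).
  under [RHS]eq_bigr do rewrite big_split/= sum_const_ord.
  rewrite big_split/= -mulr_sumr sum_const_ord -!mulr_suml.
  by rewrite -mulrDr -splitr.
rewrite expr2 big_distrlr/=; apply: ler_sum => i _; apply: ler_sum => j _.
have := sqr_ge0 (f i - f j); rewrite !expr2; lra.
Qed.

Lemma sum_shift_le (k h : nat) (f : nat -> R) : (forall i, `|f i| <= 1) ->
  `|\sum_(i < k) f (h + i)%N - \sum_(i < k) f i| <= 2 * h%:R.
Proof.
move=> f1; elim: h => [|h IH].
  by under eq_bigr do rewrite add0n; rewrite subrr normr0 mulr0.
have E : \sum_(i < k) f (h.+1 + i)%N = \sum_(i < k) f (h + i)%N + f (h + k)%N - f h.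
  elim: k {IH} => [|k IH]; first by rewrite !big_ord0 addn0 add0r subrr.
  by rewrite !big_ord_recr/= IH addSnnS; ring.
have := f1 h; have := f1 (h + k)%N; move: IH; rewrite E -natr1.
rewrite !ler_norml => /andP[? ?] /andP[? ?] /andP[? ?]; apply/andP; split; lra.
Qed.

(** Multiplying by [sin (pi a)] telescopes the sum, which is thus bounded by a constant independent
    of [p]. *)
Lemma weyl1 a : irrational a -> forall eta, 0 < eta ->
  exists K : nat, forall k, (K <= k)%N -> forall p, (forall n, fdiff p n = a) ->
  `|\sum_(i < k) ecos (p i)| <= eta * k%:R.
Proof.
move=> ia eta eta0; have s0 := esin_half_neq0 ia; set s := esin (a / 2) in s0.
have [K HK] := nat_large (eta^-1 * `|s|^-1); exists K => k /HK hk p pa.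
have E : s * \sum_(i < k) ecos (p i) = (esin (p k - a / 2) - esin (p 0 - a / 2)) / 2.
  elim: k {hk} => [|k IH]; first by rewrite big_ord0 mulr0 subrr mul0r.
  rewrite big_ord_recr/= mulrDr IH.
  have -> : p k.+1 - a / 2 = p k + a / 2 by have := pa k; rewrite /fdiff; lra.
  rewrite !esinD esinN ecosN -/s; lra.
have {}E : `|s| * `|\sum_(i < k) ecos (p i)| <= 1.
  rewrite -normrM E normrM normfV (gtr0_norm (x := 2))// ler_pdivrMr// mul1r.
  apply: le_trans (ler_normB _ _) _.
  have := sin_max (pi *+ 2 * (p k - a / 2)).
  by have := sin_max (pi *+ 2 * (p 0 - a / 2)); rewrite /esin; lra.
rewrite -(ler_pM2l (x := `|s|)) ?normr_gt0//; apply: le_trans E _.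
rewrite mulrC -mulrA -ler_pdivrMl ?mulr1//.
by rewrite -ler_pdivrMr ?normr_gt0.
Qed.

(** Averaging over [H] shifts costs [2 H^2], at most [eta / 2 * H * k]. Cauchy-Schwarz bounds the
    square of the averaged sum [X] by [k^2 H^2 (1 / H + eta^2 / 8)], where the diagonal pairs give
    [1 / H <= eta^2 / 8]. *)
Lemma van_der_corput (k H : nat) p (eta : R) : 0 < eta ->
  (0 < H)%N -> 8 <= eta ^+ 2 * H%:R -> 4 * H%:R <= eta * k%:R ->
  (forall h h' : 'I_H, h != h' ->
     \sum_(i < k) ecos (p (h + i)%N - p (h' + i)%N) <= eta ^+ 2 / 8 * k%:R) ->
  `|\sum_(i < k) ecos (p i)| <= eta * k%:R.
Proof.
move=> eta0 H0 hH hk hcorr; set C0 := \sum_(i < k) _.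
have H0' : 0 < H%:R :> R by rewrite ltr0n.
pose X := \sum_(i < k) \sum_(h < H) ecos (p (h + i)%N).
have XC : `|X - H%:R * C0| <= 2 * H%:R * H%:R.
  have -> : X - H%:R * C0 = \sum_(h < H) (\sum_(i < k) ecos (p (h + i)%N) - C0).
    by rewrite sumrB sum_const_ord /X exchange_big.
  apply: le_trans (ler_norm_sum _ _ _) _.
  apply: (@le_trans _ _ (\sum_(h < H) 2 * H%:R)); last first.
    by rewrite sum_const_ord mulrC.
  apply: ler_sum => h _; apply: le_trans (sum_shift_le _ _ (fun i => ecos_max (p i))) _.
  by rewrite ler_wpM2l// ler_nat ltnW.
have X2 : X ^+ 2 <= (eta / 2 * H%:R * k%:R) ^+ 2.
  have le1 : X ^+ 2 <= k%:R * \sum_(i < k) \sum_(h < H) \sum_(h' < H)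
      ecos (p (h + i)%N - p (h' + i)%N).
    apply: le_trans (sqr_sum_le k (fun i => \sum_(h < H) ecos (p (h + i)%N))) _.
    rewrite ler_wpM2l//; apply: ler_sum => i _.
    by rewrite -(fejer0 (fun h : 'I_H => p (h + i)%N)) lerDl sqr_ge0.
  apply: le_trans le1 _.
  have le2 : \sum_(i < k) \sum_(h < H) \sum_(h' < H) ecos (p (h + i)%N - p (h' + i)%N)
     <= \sum_(h < H) (k%:R + H%:R * (eta ^+ 2 / 8 * k%:R)).
    rewrite exchange_big/=; apply: ler_sum => h _; rewrite exchange_big/=.
    rewrite (bigD1 h)//= lerD//.
      by under eq_bigr do rewrite subrr ecos0; rewrite sum_const_ord mulr1.
    apply: (@le_trans _ _ (\sum_(h' < H | h' != h) eta ^+ 2 / 8 * k%:R)).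
      by apply: ler_sum => h' hh'; apply: hcorr; rewrite eq_sym.
    rewrite sumr_const -[_ *+ #|_|]mulr_natl; apply: ler_wpM2r.
      by rewrite mulr_ge0 ?divr_ge0 ?sqr_ge0.
    by rewrite ler_nat -[X in (_ <= X)%N](card_ord H) max_card.
  apply: le_trans (ler_wpM2l (ler0n _ _) le2) _.
  rewrite sum_const_ord.
  have k0 : 0 <= k%:R :> R by [].
  have : 0 <= k%:R * k%:R * H%:R * (eta ^+ 2 * H%:R - 8).
    by rewrite !mulr_ge0// subr_ge0.
  by rewrite !expr2; lra.
have {}X2 : `|X| <= eta / 2 * H%:R * k%:R.
  have Y0 : 0 <= eta / 2 * H%:R * k%:R by rewrite !mulr_ge0 ?invr_ge0 ?ler0n// ltW.
  by rewrite -(@ler_pXn2r _ 2%N) ?nnegrE// real_normK ?num_real.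
rewrite -(ler_pM2l H0') -[X in X * `|_|](gtr0_norm H0') -normrM.
have -> : H%:R * C0 = X - (X - H%:R * C0) by lra.
apply: le_trans (ler_normB _ _) _; apply: le_trans (lerD X2 XC) _.
have : 0 <= H%:R * (eta * k%:R - 4 * H%:R) by rewrite mulr_ge0// subr_ge0.
by lra.
Qed.

Lemma irrational_scale (a : R) (c : int) : irrational a -> c != 0 ->
  irrational (c%:~R * a).
Proof.
move=> ia c0 [q _ qE]; apply: ia; exists (q / c%:~R) => //.
by rewrite fmorph_div/= ratr_int qE mulrAC divff ?mul1r// intr_eq0.
Qed.

(** Here [K] does not depend on [p]. The induction needs this uniformity: it treats differences of
    two shifts of [p], whose top difference is a nonzero integer multiple of [a]. *)
Lemma weyl d a : irrational a -> forall eta, 0 < eta ->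
  exists K : nat, forall k, (K <= k)%N -> forall p,
  (forall n, iter d.+1 fdiff p n = a) ->
  `|\sum_(i < k) ecos (p i)| <= eta * k%:R.
Proof.
elim: d a => [|d IH] a ia eta eta0; first exact: weyl1.
have [H0 HH] := nat_large (8 / eta ^+ 2); pose H := H0.+1.
have [K HK] : exists K : nat, forall k, (K <= k)%N -> forall hh : 'I_H * 'I_H,
    hh.1 != hh.2 -> forall p,
    (forall n, iter d.+1 fdiff p n = (hh.1%:Z - hh.2%:Z)%:~R * a) ->
    `|\sum_(i < k) ecos (p i)| <= eta ^+ 2 / 8 * k%:R.
  apply: common_bound => -[h h'] /=; have [->|hh'] := eqVneq h h'.
    by exists 0%N.
  have c0 : h%:Z - h'%:Z != 0 by rewrite subr_eq0 eqz_nat.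
  have e0 : 0 < eta ^+ 2 / 8 by rewrite divr_gt0 ?exprn_gt0.
  have [K HK] := IH _ (irrational_scale ia c0) _ e0.
  by exists K => k Kk _ p pE; exact: HK.
have [K' HK'] := nat_large (4 * H%:R / eta).
exists (maxn K K') => k; rewrite geq_max => /andP[Kk K'k] p pE.
apply: (@van_der_corput k H) => //.
- have := HH H (leqnSn _); rewrite ler_pdivrMr ?exprn_gt0//.
  by rewrite mulrC.
- by have := HK' _ K'k; rewrite ler_pdivrMr// [_ * eta]mulrC.
- move=> h h' hh'; apply: le_trans (ler_norm _) _.
  apply: (HK k Kk (h, h') hh' (fun i => p (h + i)%N - p (h' + i)%N)) => n.
  rewrite iter_fdiffB !iter_fdiff_shift.
  (* One order below the top, the differences of [p] form an arithmetic progression. *)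
  have L i : iter d.+1 fdiff p i = iter d.+1 fdiff p 0 + i%:R * a.
    elim: i => [|i IHi]; first by rewrite mul0r addr0.
    by have := pE i; rewrite iter_fdiffS IHi -natr1; lra.
  by rewrite (L (h + n)%N) (L (h' + n)%N) intrB !natrD -!pmulrn; ring.
Qed.

End Weyl.

(** * Words determine cells *)

Section SameCode.
Variable R : realType.
Implicit Types (x y : R) (g h q : nat -> R).

Local Notation ecos := (@ecos R).
Local Notation esin := (@esin R).

Lemma ecos_half x : ecos x = 1 - 2 * esin (x / 2) ^+ 2.
Proof.
rewrite [in LHS](_ : x = x / 2 + x / 2) ?ecosD -?splitr//.
by have := ecos_sqr (x / 2); rewrite !expr2; lra.
Qed.

Lemma esinDz x (z : int) : esin (x + z%:~R) = esin x.
Proof.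
have esinDn y (n : nat) : esin (y + n%:R) = esin y.
  by rewrite /esin mulrDr mulr_natr (periodicn (@sinD2pi R)).
case: z => n; first exact: esinDn.
by rewrite NegzE -[LHS](esinDn _ n.+1) mulrNz subrK.
Qed.

(** Removing an even integer from [x] leaves [y] or [y + 1], with [y] the fractional part, and
    [sin (pi y) >= 0]. *)
Lemma esin_half_sign x : 0 <= (-1) ^+ odd `|Num.floor x| * esin (x / 2).
Proof.
set f := Num.floor x; set y := x - f%:~R.
have /andP[y0 y1] : 0 <= y < 1.
  have /andP[? ?] := floor_itv x; rewrite /y subr_ge0 ltrBlDr addrC.
  by rewrite -[X in _ + X]/(1%:~R) -intrD; apply/andP.
have sy : 0 <= esin (y / 2).
  rewrite /esin (_ : pi *+ 2 * (y / 2) = pi * y); last by rewrite mulr2n; field.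
  by apply: sin_ge0_pi; rewrite mulr_ge0 ?pi_ge0//= ger_pMr ?pi_gt0// ltW.
have [w [b [fE bE]]] : exists (w : int) (b : bool), f = 2 * w + b%:Z /\ odd `|f| = b.
  have := odd_double_half `|f|; case: (odd _) => fE.
    have [E|E] : f = `|f|%N%:Z \/ f = - `|f|%N%:Z by lia.
    - by exists `|f|./2%:Z, true; split=> //; lia.
    - by exists (- `|f|./2%:Z - 1), true; split=> //; lia.
  have [E|E] : f = `|f|%N%:Z \/ f = - `|f|%N%:Z by lia.
  - by exists `|f|./2%:Z, false; split=> //; lia.
  - by exists (- `|f|./2%:Z), false; split=> //; lia.
rewrite bE (_ : x / 2 = y / 2 + b%:R / 2 + w%:~R); last first.
  by rewrite /y fE intrD intrM -pmulrn; field.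
rewrite esinDz; case: b {fE bE} => /=; last by rewrite mul0r addr0 mul1r.
rewrite expr1 mulN1r oppr_ge0 /esin mulrDr.
rewrite (_ : pi *+ 2 * (1 / 2) = pi); last by rewrite mulr2n; field.
by rewrite sinDpi oppr_le0.
Qed.

Lemma esin_half_mul_ge0 x y : odd `|Num.floor x| = odd `|Num.floor y| ->
  0 <= esin (x / 2) * esin (y / 2).
Proof.
have := esin_half_sign x; have := esin_half_sign y => hy hx E.
by have := mulr_ge0 hx hy; rewrite E mulrACA -expr2 sqrr_sign mul1r.
Qed.

Lemma sum_succ_pairs M :
  \sum_(a < M.+1) \sum_(b < M.+1) (b == a.+1 :> nat)%:R = M%:R :> R.
Proof.
rewrite exchange_big big_ord_recl/= big1// add0r.
rewrite -[RHS]mulr1 -sum_const_ord; apply: eq_bigr => c _.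
rewrite (bigD1 (widen_ord (leqnSn M) c))//= /bump leq0n add1n eqxx big1 ?addr0// => a ac.
rewrite eqSS; case: eqP => // E; case/eqP: ac; apply: val_inj => /=.
by rewrite E.
Qed.

(** Equal signs give [cos (2 pi X) <= cos (2 pi q)] for [X = (g + h) / 2] and [q = (g - h) / 2].
    Under the Fejer kernel in [X] with [N] frequencies the left side averages to about [N - 1], and
    the right side to about [N] times the mean of [cos (2 pi q)], as [q] does not affect the top
    difference. So this mean is at least about [1 - 1 / N]. *)
Lemma same_code_average d (beta eta : R) : irrational beta -> 0 < eta ->
  exists K : nat, forall k, (K <= k)%N -> forall g h,
  (forall n, iter d.+1 fdiff g n = beta) ->
  (forall n, iter d.+1 fdiff h n = beta) ->
  (forall i, (i < k)%N -> 0 <= esin (g i / 2) * esin (h i / 2)) ->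
  \sum_(i < k) (1 - ecos ((g i - h i) / 2)) <= eta * k%:R.
Proof.
move=> ib eta0.
have [M0 HM] := nat_large (2 / eta); pose M := M0; pose N := M.+1.
have N0 : 0 < N%:R :> R by rewrite ltr0n.
have NH : 2 <= eta * N%:R.
  by have := HM N (leqnSn _); rewrite ler_pdivrMr// [_ * eta]mulrC.
(* The final loss is [1 / N + 2 N e] per index: [1 / N <= eta / 2] by the choice of [N], and
   [2 N e = eta / 2]. *)
pose e := eta / (4 * N%:R); have e0 : 0 < e by rewrite divr_gt0// mulr_gt0.
have W (c : int) : exists K : nat, forall k, (K <= k)%N -> c != 0 -> forall p,
    (forall n, iter d.+1 fdiff p n = c%:~R * beta) ->
    `|\sum_(i < k) ecos (p i)| <= e * k%:R.
  have [->|c0] := eqVneq c 0; first by exists 0%N.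
  have [K HK] := weyl d (irrational_scale ib c0) e0.
  by exists K => k Kk _; exact: HK.
have [K1 HK1] : exists K : nat, forall k, (K <= k)%N -> forall ab : 'I_N * 'I_N,
    ab.1%:Z - ab.2%:Z != 0 -> forall p,
    (forall n, iter d.+1 fdiff p n = (ab.1%:Z - ab.2%:Z)%:~R * beta) ->
    `|\sum_(i < k) ecos (p i)| <= e * k%:R.
  by apply: common_bound => ab; exact: W.
have [K2 HK2] : exists K : nat, forall k, (K <= k)%N -> forall ab : 'I_N * 'I_N,
    ab.1%:Z - ab.2%:Z + 1 != 0 -> forall p,
    (forall n, iter d.+1 fdiff p n = (ab.1%:Z - ab.2%:Z + 1)%:~R * beta) ->
    `|\sum_(i < k) ecos (p i)| <= e * k%:R.
  by apply: common_bound => ab; exact: W.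
exists (maxn K1 K2) => k; rewrite geq_max => /andP[K1k K2k] g h gb hb gh.
have ek0 : 0 <= e * k%:R by rewrite mulr_ge0// ltW.
pose X i := (g i + h i) / 2; pose q i := (g i - h i) / 2.
have Xb n : iter d.+1 fdiff X n = beta.
  rewrite (_ : X = fun i => 2^-1 * (g i + h i)); last by apply/funext => i; rewrite mulrC.
  by rewrite iter_fdiffZ iter_fdiffD gb hb; field.
have q0 n : iter d.+1 fdiff q n = 0.
  rewrite (_ : q = fun i => 2^-1 * (g i - h i)); last by apply/funext => i; rewrite mulrC.
  by rewrite iter_fdiffZ iter_fdiffB gb hb subrr mulr0.
pose w i := (\sum_(a < N) ecos (a%:R * X i)) ^+ 2 + (\sum_(a < N) esin (a%:R * X i)) ^+ 2.
have wE (y : nat -> R) : \sum_(i < k) w i * ecos (y i) =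
    \sum_(a < N) \sum_(b < N) \sum_(i < k) ecos ((a%:R - b%:R) * X i + y i).
  under eq_bigr do rewrite fejer.
  rewrite exchange_big; apply: eq_bigr => a _.
  rewrite exchange_big; apply: eq_bigr => b _.
  by apply: eq_bigr => i _; rewrite mulrBl.
(* cos Q - cos X = 2 sin U sin V for U = (X + Q) / 2 and V = (X - Q) / 2. *)
have le1 : \sum_(i < k) w i * ecos (X i) <= \sum_(i < k) w i * ecos (q i).
  apply: ler_sum => i _; rewrite ler_wpM2l ?addr_ge0 ?sqr_ge0//.
  rewrite /X /q (mulrDl (g i)) (mulrBl _ (g i)) !ecosD esinN ecosN.
  by have := gh i (ltn_ord i); lra.
have le2 : \sum_(i < k) w i * ecos (q i) <=
    N%:R * (\sum_(i < k) ecos (q i) + N%:R * (e * k%:R)).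
  rewrite wE -sum_const_ord; apply: ler_sum => a _.
  rewrite (bigD1 a)//= lerD//.
    by apply: ler_sum => i _; rewrite subrr mul0r add0r.
  apply: (@le_trans _ _ (\sum_(b < N | b != a) e * k%:R)).
    apply: ler_sum => b ba; apply: le_trans (ler_norm _) _.
    apply: (HK1 k K1k (a, b) _ (fun i => (a%:R - b%:R) * X i + q i)) => [|n].
      by rewrite subr_eq0 eqz_nat eq_sym.
    by rewrite iter_fdiffD iter_fdiffZ Xb q0 addr0 intrB -!pmulrn.
  rewrite -sum_const_ord [in leRHS](bigID (fun b => b != a))/= lerDl.
  exact: sumr_ge0.
have le3 : M%:R * k%:R - N%:R * (N%:R * (e * k%:R)) <= \sum_(i < k) w i * ecos (X i).
  have -> : M%:R * k%:R - N%:R * (N%:R * (e * k%:R)) = \sum_(a < N) \sum_(b < N)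
      ((b == a.+1 :> nat)%:R * k%:R - e * k%:R).
    under [RHS]eq_bigr do rewrite sumrB sum_const_ord -mulr_suml.
    by rewrite sumrB sum_const_ord -mulr_suml sum_succ_pairs.
  rewrite wE; apply: ler_sum => a _; apply: ler_sum => b _.
  have [ba|ba] := eqVneq (b : nat) a.+1.
    rewrite mul1r; apply: (@le_trans _ _ k%:R); first by rewrite gerBl.
    rewrite -[leLHS]mulr1 -sum_const_ord; apply: ler_sum => i _.
    by rewrite ba -natr1 (_ : _ + X i = 0) ?ecos0//; ring.
  rewrite mul0r sub0r lerNl; apply: le_trans (ler_norm _) _; rewrite normrN.
  apply: (HK2 k K2k (a, b) _ (fun i => (a%:R - b%:R) * X i + X i)) => [|n].
    by apply/eqP => E; move/eqP: ba; apply; move: E => /=; lia.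
  by rewrite iter_fdiffD iter_fdiffZ Xb intrD intrB -!pmulrn; ring.
rewrite sumrB -[\sum_(i < k) 1]mulr1.
have -> : \sum_(i < k) 1 = k%:R :> R by rewrite sum_const_ord mulr1.
have le4 := le_trans le3 (le_trans le1 le2); rewrite -(ler_pM2l N0) -/q mulr1.
have eN : e * N%:R = eta / 4 by rewrite /e; field; rewrite gt_eqF.
have NeE : N%:R * (e * k%:R) = eta / 4 * k%:R by rewrite -eN; ring.
have ME : M%:R = N%:R - 1 :> R by rewrite -natr1 addrK.
have : 0 <= (eta * N%:R - 2) * k%:R by rewrite mulr_ge0// subr_ge0.
by rewrite ME NeE in le4; lra.
Qed.

(** Half the squared distance from [e(x)] to 1. It replaces the distance to the nearest integer, and
    obeys the triangle inequality up to a factor 2. *)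
Definition chord x : R := 1 - ecos x.

Lemma chord_ge0 x : 0 <= chord x.
Proof. by rewrite /chord subr_ge0; apply: le_trans (ler_norm _) (ecos_max _). Qed.

Lemma chordD x y : chord (x + y) <= 2 * chord x + 2 * chord y.
Proof.
rewrite /chord !ecos_half (mulrDl x) esinD.
have := ecos_sqr (x / 2); have := ecos_sqr (y / 2).
move: (ecos _) (esin _) (ecos _) (esin _) => c s c' s' h1 h2.
have c2 : c ^+ 2 = 1 - s ^+ 2 by lra.
have c2' : c' ^+ 2 = 1 - s' ^+ 2 by lra.
have E : (s * c' + c * s') ^+ 2 =
    2 * (s ^+ 2 * c' ^+ 2 + c ^+ 2 * s' ^+ 2) - (s * c' - c * s') ^+ 2 by ring.
have := sqr_ge0 (s * c' - c * s').
have : 0 <= s ^+ 2 * s' ^+ 2 by rewrite mulr_ge0 ?sqr_ge0.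
rewrite E c2 c2'; lra.
Qed.

Lemma chordN x : chord (- x) = chord x.
Proof. by rewrite /chord ecosN. Qed.

End SameCode.

(** * From small averages to nearby integer sequences *)

Section SameCell.
Variable R : realType.
Implicit Types (x y : R) (q f : nat -> R).

Local Notation ecos := (@ecos R).
Local Notation chord := (@chord R).

Lemma chord0 : chord 0 = 0.
Proof. by rewrite /chord ecos0 subrr. Qed.

Lemma chordB x y : chord (x - y) <= 2 * chord x + 2 * chord y.
Proof. by rewrite -[chord y]chordN chordD. Qed.

(** [f 0] is an integer combination of the next [d] values, and [chord] is subadditive up to a
    factor. The induction writes [f 0 = f 1 - fdiff f 0], whence the constant [2 + 2 * C * 4]. *)
Lemma chord_extrapolate_left d : exists2 C : R, 0 <= C &
  forall f, iter d fdiff f 0 = 0 ->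
    chord (f 0) <= C * \sum_(j < d) chord (f j.+1).
Proof.
elim: d => [|d [C C0 HC]].
  by exists 0 => // f /= ->; rewrite chord0 mul0r.
exists (2 + 8 * C); first by rewrite addr_ge0// mulr_ge0.
move=> f f0; have := HC (fdiff f); rewrite -iterSr => /(_ f0) h1.
set S := \sum_(j < d.+1) _.
have h2 : \sum_(j < d) chord (fdiff f j.+1) <= 4 * S.
  apply: (@le_trans _ _ (\sum_(j < d) (2 * chord (f j.+2) + 2 * chord (f j.+1)))).
    by apply: ler_sum => j _; exact: chordB.
  rewrite big_split/= -!mulr_sumr.
  have : \sum_(j < d) chord (f j.+2) <= S by rewrite /S big_ord_recl lerDr chord_ge0.
  have : \sum_(j < d) chord (f j.+1) <= S by rewrite /S big_ord_recr lerDl chord_ge0.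
  lra.
have h3 : chord (f 1%N) <= S.
  by rewrite /S big_ord_recl lerDl sumr_ge0// => i _; exact: chord_ge0.
have := chordB (f 1%N) (fdiff f 0); rewrite {1}/fdiff subKr.
have := ler_wpM2l C0 h2; lra.
Qed.

Lemma chord_extrapolate_right d : exists2 C : R, 0 <= C &
  forall f, iter d fdiff f 0 = 0 ->
    chord (f d) <= C * \sum_(j < d) chord (f j).
Proof.
elim: d => [|d [C C0 HC]].
  by exists 0 => // f /= ->; rewrite chord0 mul0r.
exists (2 + 8 * C); first by rewrite addr_ge0// mulr_ge0.
move=> f f0; have := HC (fdiff f); rewrite -iterSr => /(_ f0) h1.
set S := \sum_(j < d.+1) _.
have h2 : \sum_(j < d) chord (fdiff f j) <= 4 * S.
  apply: (@le_trans _ _ (\sum_(j < d) (2 * chord (f j.+1) + 2 * chord (f j)))).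
    by apply: ler_sum => j _; exact: chordB.
  rewrite big_split/= -!mulr_sumr.
  have : \sum_(j < d) chord (f j.+1) <= S by rewrite /S big_ord_recl lerDr chord_ge0.
  have : \sum_(j < d) chord (f j) <= S by rewrite /S big_ord_recr lerDl chord_ge0.
  lra.
have h3 : chord (f d) <= S.
  by rewrite /S big_ord_recr lerDr sumr_ge0// => i _; exact: chord_ge0.
have := chordD (f d) (fdiff f d); rewrite {1}/fdiff addrC subrK.
have := ler_wpM2l C0 h2; lra.
Qed.

Lemma sum_inj_le (H k : nat) (phi : nat -> nat) f : (forall i, 0 <= f i) ->
  (forall i, (i < H)%N -> (phi i < k)%N) ->
  (forall i j, (i < H)%N -> (j < H)%N -> phi i = phi j -> i = j) ->
  \sum_(i < H) f (phi i) <= \sum_(i < k) f i.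
Proof.
move=> f0 phik phiI.
pose psi (i : 'I_H) : 'I_k := Ordinal (phik i (ltn_ord i)).
have psiI : injective psi.
  by move=> i j /(congr1 val)/= e; apply: val_inj; exact: phiI e.
have -> : \sum_(i < H) f (phi i) = \sum_(i in [set psi i | i in [set: 'I_H]]) f i.
  rewrite big_imset/=; last by move=> i j _ _; exact: psiI.
  by apply: eq_bigl => i; rewrite !inE.
by rewrite [leRHS](bigID (fun i => i \in [set psi i | i in [set: 'I_H]]))/= lerDl sumr_ge0.
Qed.

(** The value at [p] is extrapolated along [H] progressions that start or end at [p], with steps
    [1, ..., H]. For each rank [j] their indices are distinct, so the [H] bounds together use the
    total [S] at most [D] times; and [H] is at least [k / (4 D)]. *)
Lemma chord_pointwise d : exists2 C : R, 0 < C &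
  forall (k : nat) q (eta : R), (2 * d.+1 <= k)%N ->
  (forall n, iter d.+1 fdiff q n = 0) ->
  \sum_(i < k) chord (q i) <= eta * k%:R ->
  forall p, (p < k)%N -> chord (q p) <= C * eta.
Proof.
have [C1 C10 HC1] := chord_extrapolate_left d.+1.
have [C2 C20 HC2] := chord_extrapolate_right d.+1.
set D := d.+1; pose C := C1 + C2 + 1; have C0 : 0 < C by rewrite ltr_wpDl ?addr_ge0.
have D0 : 0 < D%:R :> R by rewrite ltr0n.
exists (C * D%:R * (4 * D%:R)); first by rewrite !mulr_gt0.
move=> k q eta Dk q0 Sq p pk; pose H := (k %/ (2 * D))%N.
set S := \sum_(i < k) chord (q i) in Sq.
have S0 : 0 <= S by apply: sumr_ge0 => i _; exact: chord_ge0.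
have HD : (2 * (H * D) <= k)%N by have := leq_trunc_div k (2 * D); rewrite /H; lia.
have H0 : (0 < H)%N by rewrite divn_gt0// muln_gt0.
have kH : (k <= 4 * D * H)%N.
  by have := ltn_ceil k (_ : 0 < 2 * D)%N; rewrite -/H muln_gt0 /= => /(_ isT); nia.
suff HF : H%:R * chord (q p) <= C * D%:R * S.
  have kH' : k%:R <= 4 * D%:R * H%:R :> R by rewrite -!natrM ler_nat.
  have H0' : 0 < H%:R :> R by rewrite ltr0n.
  rewrite -(ler_pM2l H0'); apply: le_trans HF _.
  have eta0 : 0 <= eta.
    have k0 : 0 < k%:R :> R by rewrite ltr0n; lia.
    by rewrite -(pmulr_lge0 _ k0) (le_trans S0).
  have h1 : C * D%:R * S <= C * D%:R * (eta * k%:R) by rewrite ler_wpM2l// mulr_ge0// ltW.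
  apply: le_trans h1 _.
  have h2 : C * D%:R * eta * k%:R <= C * D%:R * eta * (4 * D%:R * H%:R).
    by rewrite ler_wpM2l// !mulr_ge0// ltW.
  lra.
have inner (phi : nat -> nat -> nat) :
    (forall j h, (j < D)%N -> (h < H)%N -> (phi j h < k)%N) ->
    (forall j h h', (j < D)%N -> (h < H)%N -> (h' < H)%N ->
       phi j h = phi j h' -> h = h') ->
    \sum_(h < H) \sum_(j < D) chord (q (phi j h)) <= D%:R * S.
  move=> h1 h2; rewrite exchange_big -sum_const_ord; apply: ler_sum => j _.
  apply: (sum_inj_le (f := fun i => chord (q i))) => [i|i iH|i i' iH iH'].
  - exact: chord_ge0.
  - exact: h1.
  - exact: h2.
have DS0 : 0 <= D%:R * S by rewrite mulr_ge0.
(* If there is no room to the right of [p], there is to its left, because [2 * H * D <= k]. *)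
have [pH|Hp] := ltnP (p + H * D) k.
  apply: (@le_trans _ _ (C1 * (D%:R * S))); last first.
    by rewrite -mulrA ler_wpM2r// /C; lra.
  apply: (@le_trans _ _ (C1 * \sum_(h < H) \sum_(j < D) chord (q (p + h.+1 * j.+1)%N))).
    rewrite mulr_sumr -sum_const_ord; apply: ler_sum => h _.
    have := HC1 (fun j => q (p + h.+1 * j)%N); rewrite muln0 addn0; apply.
    exact: (iter_fdiff_dilate h.+1 q0 p 0).
  rewrite ler_wpM2l//; apply: (inner (fun j h => p + h.+1 * j.+1)%N).
    by move=> j h jD hH; apply: leq_trans pH; rewrite ltnS leq_add2l leq_mul.
  by move=> j h h' _ _ _ /addnI /eqP; rewrite eqn_pmul2r// eqSS => /eqP.
apply: (@le_trans _ _ (C2 * (D%:R * S))); last first.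
  by rewrite -mulrA ler_wpM2r// /C; lra.
apply: (@le_trans _ _ (C2 * \sum_(h < H) \sum_(j < D) chord (q (p - h.+1 * D + h.+1 * j)%N))).
  rewrite mulr_sumr -sum_const_ord; apply: ler_sum => h _.
  have := HC2 (fun j => q (p - h.+1 * D + h.+1 * j)%N); rewrite subnK.
    apply; exact: (iter_fdiff_dilate h.+1 q0 _ 0).
  by have := leq_mul (ltn_ord h) (leqnn D); lia.
rewrite ler_wpM2l//; apply: (inner (fun j h => p - h.+1 * D + h.+1 * j)%N).
  move=> j h jD hH; apply: leq_ltn_trans pk.
  have : (h.+1 * j <= h.+1 * D)%N by rewrite leq_mul// ltnW.
  have : (h.+1 * D <= H * D)%N by rewrite leq_mul.
  lia.
move=> j h h' jD hH hH' E.
have e1 : (h.+1 * D <= H * D)%N by rewrite leq_mul.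
have e2 : (h'.+1 * D <= H * D)%N by rewrite leq_mul.
have : (h.+1 * (D - j) = h'.+1 * (D - j))%N by rewrite !mulnBr; nia.
by move/eqP; rewrite eqn_pmul2r ?subn_gt0// eqSS => /eqP.
Qed.

(** [cos] decreases on [[0, pi]]; capping [eps] at one half keeps [2 pi e] in this interval. *)
Lemma chord_small (eps : R) : 0 < eps -> exists2 eta, 0 < eta &
  forall x, chord x < eta -> exists z : int, `|x - z%:~R| < eps.
Proof.
move=> eps0; pose e := Num.min eps (1 / 2).
have e0 : 0 < e by rewrite lt_min eps0 divr_gt0.
have e2 : e <= 1 / 2 by rewrite ge_min lexx orbT.
have piE x : pi *+ 2 * x = pi * (2 * x) :> R by rewrite mulr2n; ring.
have Ipi x : 0 <= x -> x <= 1 / 2 -> pi *+ 2 * x \in `[(0 : R), pi].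
  move=> x0 x1; rewrite in_itv/= piE mulr_ge0 ?pi_ge0 ?mulr_ge0//=.
  by rewrite ger_pMr ?pi_gt0//; lra.
exists (chord e).
  rewrite /chord /ecos subr_gt0 -cos0 ltr_cos ?Ipi ?(ltW e0)//.
    by rewrite mulr_gt0// mulrn_wgt0// pi_gt0.
  by rewrite in_itv/= lexx pi_ge0.
move=> x; pose z := Num.floor (x + 1 / 2); pose y := x - z%:~R.
have -> : chord x = chord y by rewrite /chord -(ecosDz y z) subrK.
have y2 : `|y| <= 1 / 2.
  have := floor_itv (x + 1 / 2); rewrite -/z intrD /y => /andP[? ?].
  by rewrite ler_norml; apply/andP; split; lra.
have -> : chord y = chord `|y|.
  by have [y0|y0] := ger0P y; rewrite ?chordN.
move=> lt_ye; exists z; rewrite -/y.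
have : `|y| < e.
  rewrite ltNge; apply/negP => ey; move: lt_ye; rewrite ltNge => /negP; apply.
  rewrite /chord lerD2l lerN2 /ecos leNgt ltr_cos ?Ipi ?(ltW e0)//.
  by rewrite -leNgt ler_wpM2l// mulrn_wge0// pi_ge0.
by rewrite lt_min => /andP[].
Qed.

(** In the expansion of [iter d fdiff f m] the term [f (m + d)] has coefficient 1, and the other
    coefficients have absolute values of sum [2 ^ d - 1]. *)
Lemma iter_fdiff_bound d f m (eps : R) :
  (forall j, (j < d)%N -> `|f (m + j)%N| <= eps) ->
  `|iter d fdiff f m - f (m + d)%N| <= (2 ^+ d - 1) * eps.
Proof.
elim: d m => [|d IH] m fe; first by rewrite addn0 subrr normr0 expr0 subrr mul0r.
have h1 : `|iter d fdiff f m.+1 - f (m.+1 + d)%N| <= (2 ^+ d - 1) * eps.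
  by apply: IH => j jd; rewrite addSnnS fe.
have h2 : `|iter d fdiff f m - f (m + d)%N| <= (2 ^+ d - 1) * eps.
  by apply: IH => j jd; rewrite fe// ltnW.
have h3 := fe d (ltnSn d).
rewrite iter_fdiffS -addSnnS exprS.
by move: h1 h2 h3; rewrite !ler_norml => /andP[? ?] /andP[? ?] /andP[? ?]; apply/andP; split; lra.
Qed.

Lemma int_lt1_eq0 (z : int) : `|z%:~R| < 1 :> R -> z = 0.
Proof. by rewrite -intr_norm -[1]/(1%:~R) ltr_int; lia. Qed.

(** Let [z] interpolate the nearby integers [r] at the first [d] indices. Inductively [q - z] is
    small at [d] consecutive indices, hence at the next one, where the integer [z i - r i] is then
    less than 1 in absolute value. *)
Lemma near_int_polynomial d (eps : R) k q : 0 < eps -> (2 ^+ d + 1) * eps < 1 ->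
  (forall n, iter d fdiff q n = 0) ->
  (forall i, (i < k)%N -> exists z : int, `|q i - z%:~R| <= eps) ->
  exists2 z : nat -> int, (forall n, iter d fdiff z n = 0) &
    forall i, (i < k)%N -> `|q i - (z i)%:~R| <= eps.
Proof.
move=> eps0 eps1 q0 qn.
have /choice[r rP] : forall i, exists z : int, (i < k)%N -> `|q i - z%:~R| <= eps.
  by move=> i; case: (ltnP i k) => [/qn[z hz]|_]; [exists z|exists 0].
have [z z0 zr] := fdiff_interp_init d r.
exists z => // i; elim/ltn_ind: i => i IH ik.
have [id|di] := ltnP i d; first by rewrite zr// rP.
pose f n := q n - (z n)%:~R.
have f0 : iter d fdiff f (i - d)%N = 0.
  rewrite iter_fdiffB q0 sub0r.
  have E l n : iter l fdiff (fun n => (z n)%:~R : R) n = (iter l fdiff z n)%:~R.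
    by elim: l n => // l IHl n; rewrite !iter_fdiffS !IHl rmorphB.
  by rewrite E z0 oppr0.
have : `|iter d fdiff f (i - d)%N - f (i - d + d)%N| <= (2 ^+ d - 1) * eps.
  apply: iter_fdiff_bound => j jd; apply: IH; last by lia.
  by lia.
rewrite f0 sub0r normrN subnK// => fi.
have ri := rP i ik.
suff -> : z i = r i by [].
apply/eqP; rewrite -subr_eq0; apply/eqP; apply: int_lt1_eq0.
rewrite intrB; apply: le_lt_trans eps1.
have -> : (z i)%:~R - (r i)%:~R = (q i - (r i)%:~R) - f i by rewrite /f; ring.
apply: le_trans (ler_normB _ _) _; apply: le_trans (lerD ri fi) _.
have : 0 <= eps by exact: ltW.
lra.
Qed.

Lemma eq_of_parity (a b z : int) : odd `|b| = odd `|a| ->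
  - 2 < b - a - 2 * z -> b - a - 2 * z < 2 -> b = a + 2 * z.
Proof.
move=> par lo hi; have := odd_double_half `|a|; have := odd_double_half `|b|.
rewrite par -!muln2; move: (nat_of_bool _) => t hb ha.
have [w E] : exists w : int, b - a = 2 * w.
  have [Ea|Ea] : a = `|a|%N%:Z \/ a = - `|a|%N%:Z by lia.
    have [Eb|Eb] : b = `|b|%N%:Z \/ b = - `|b|%N%:Z by lia.
      by exists (`|b|./2%:Z - `|a|./2%:Z); lia.
    by exists (- `|b|./2%:Z - `|a|./2%:Z - t%:Z); lia.
  have [Eb|Eb] : b = `|b|%N%:Z \/ b = - `|b|%N%:Z by lia.
    by exists (`|b|./2%:Z + `|a|./2%:Z + t%:Z); lia.
  by exists (- `|b|./2%:Z + `|a|./2%:Z); lia.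
by lia.
Qed.

Lemma same_code_cell_eq d (beta : R) : irrational beta ->
  exists K : nat, forall k, (K <= k)%N -> forall g h,
  int_at d beta [::] g -> int_at d beta [::] h ->
  (forall i, (i < k)%N -> odd `|Num.floor (g i)| = odd `|Num.floor (h i)|) ->
  cell_eq d 2 (iota 0 k) g h.
Proof.
case: d => [|d] ib.
  exists 0%N => k _ g h [gb _] [hb _] _; apply: cell_eq_floor => u _.
  by have /= -> := gb u; have /= -> := hb u.
(* With [(2 ^ d.+1 + 1) * eps = 1 / 4], integrality propagates along the window. As also
   [eps <= 1 / 4], the floors of [g i] and [h i + 2 z i] differ by less than 2, and equal parity
   makes them equal. *)
pose eps : R := 1 / (4 * (2 ^+ d.+1 + 1)).
have p1 : 1 <= 2 ^+ d.+1 :> R by rewrite exprn_ege1 ?ler1n.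
have p0 : 0 < 4 * (2 ^+ d.+1 + 1) :> R by lra.
have eps0 : 0 < eps by rewrite divr_gt0.
have epsE : (2 ^+ d.+1 + 1) * eps = 1 / 4 by rewrite /eps; field; rewrite gt_eqF//; lra.
have eps4 : eps <= 1 / 4.
  by rewrite -epsE ler_pMl//; lra.
have [eta eta0 Heta] := chord_small eps0.
have [C C0 HC] := chord_pointwise d.
have eta'0 : 0 < eta / (2 * C) by rewrite divr_gt0// mulr_gt0.
have [K HK] := same_code_average d ib eta'0.
exists (maxn K (2 * d.+1)) => k; rewrite geq_max => /andP[Kk dk] g h [gb _] [hb _] gh.
pose q i := (g i - h i) / 2.
have q0 n : iter d.+1 fdiff q n = 0.
  rewrite (_ : q = fun i => 2^-1 * (g i - h i)); last by apply/funext => i; rewrite mulrC.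
  by rewrite iter_fdiffZ iter_fdiffB gb hb subrr mulr0.
have av := HK k Kk g h gb hb (fun i ik => esin_half_mul_ge0 (gh i ik)).
have pw := HC k q _ dk q0 av.
have [z z0 zq] : exists2 z : nat -> int, (forall n, iter d.+1 fdiff z n = 0) &
    forall i, (i < k)%N -> `|q i - (z i)%:~R| <= eps.
  apply: near_int_polynomial => //; first by rewrite epsE; lra.
  move=> i ik; have [|z hz] := Heta (q i); last by exists z; exact: ltW.
  apply: le_lt_trans (pw i ik) _.
  by rewrite mulrC invfM mulrA divfK ?gt_eqF//; lra.
exists z => // i; rewrite mem_iota add0n => /= ik.
have := zq i ik; have := gh i ik; have := floor_itv (g i); have := floor_itv (h i).
set a := Num.floor _; set b := Num.floor _ => /andP[h1 h2] /andP[g1 g2] par.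
rewrite /q ler_norml => /andP[z1 z2]; rewrite !intrD in h2 g2.
have lo : (-2)%:~R < (b - a - 2 * z i)%:~R :> R by rewrite !intrB intrM; lra.
have hi : (b - a - 2 * z i)%:~R < 2%:~R :> R by rewrite !intrB intrM; lra.
rewrite ltr_int in lo; rewrite ltr_int in hi.
exact: eq_of_parity.
Qed.

End SameCell.

(** * Density of the orbit *)

Section Density.
Variable R : realType.
Implicit Types (x y : R) (p f : nat -> R).

Local Notation ecos := (@ecos R).
Local Notation esin := (@esin R).
Local Notation chord := (@chord R).

(** * A Fejer kernel on the torus of jets *)

Section Orbit.
Variables (d : nat) (alpha : R) (p : nat -> R) (t : nat -> R).
Hypothesis alpha_irrational : irrational alpha.
Hypothesis pE : forall n, iter d.+1 fdiff p n = alpha.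

Let x (j n : nat) : R := iter j fdiff p n - t j.

(** The term of least index [j0] with [c j0 != 0] has the highest degree: [d - j0 + 1] differences
    kill the others and leave [c j0 * alpha]. Nonvanishing is asked after [K], so that
    [common_bound] applies to all coefficient vectors of a finite family. *)
Lemma jet_sum_oscillates (c : 'I_d.+1 -> int) (e : R) : 0 < e ->
  exists K : nat, forall k, (K <= k)%N -> (exists j, c j != 0) ->
    `|\sum_(i < k) ecos (\sum_j (c j)%:~R * x j i)| <= e * k%:R.
Proof.
move=> e0; have [[j1 cj1]|nc] := pselect (exists j, c j != 0); last by exists 0%N.
have [j0 cj0 min_j0] := @arg_minnP _ j1 (fun j => c j != 0) (fun j => j : nat) cj1.
have [K HK] := weyl (d - j0) (irrational_scale alpha_irrational cj0) e0.
exists K => k Kk _; apply: (HK k Kk (fun i => \sum_j (c j)%:~R * x j i)) => n.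
have p0 m : (d.+1 < m)%N -> forall i, iter m fdiff p i = 0.
  by move=> dm; apply: iter_fdiff_le dm _ => i; rewrite iter_fdiffS !pE subrr.
rewrite iter_fdiff_sum (bigD1 j0)// big1.
  apply: etrans (addr0 _) _.
  rewrite iter_fdiffZ iter_fdiffB iter_fdiff_const// subr0 iter_fdiff_comp.
  have jd : (j0 <= d)%N by rewrite -ltnS.
  by rewrite addSn subnK// pE.
move=> j jj0; rewrite iter_fdiffZ; have [->|cj] := eqVneq (c j) 0; first by rewrite mul0r.
rewrite iter_fdiffB iter_fdiff_const// subr0 iter_fdiff_comp p0 ?mulr0//.
have : (j0 < j)%N by rewrite ltn_neqAle min_j0// andbT eq_sym.
by have := ltn_ord j0; lia.
Qed.

Variable M : nat.
(** The frequencies form a box, so [w] is a product of one-dimensional Fejer kernels in the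
    coordinates [x j]. *)
Let A := {ffun 'I_d.+1 -> 'I_M.+1}.
Let theta (a : A) n := \sum_j (a j)%:R * x j n.
Let w n := (\sum_a ecos (theta a n)) ^+ 2 + (\sum_a esin (theta a n)) ^+ 2.

Lemma card_max_coordinate (j : 'I_d.+1) :
  (M.+1 * #|[set a : A | a j == ord_max]| = #|A|)%N.
Proof.
have -> : #|[set a : A | a j == ord_max]| =
    #|family (fun i => if i == j then pred1 (ord_max : 'I_M.+1) else predT)|.
  rewrite cardsE; apply: eq_card => a; apply/idP/familyP => [aj i|/(_ j)].
    by case: (eqVneq i j) => [->|_]; rewrite inE.
  by rewrite eqxx inE.
rewrite card_family foldrE big_map big_enum (bigD1 j)//= eqxx card1 mul1n.
rewrite card_ffun !card_ord.
transitivity (M.+1 * \prod_(i < d.+1 | i != j) M.+1)%N.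
  by congr (_ * _)%N; apply: eq_bigr => i /negPf ->; rewrite card_ord.
by rewrite -(bigD1 j (P := xpredT) (F := fun=> M.+1))//= prod_nat_const card_ord.
Qed.

Let succ_at (j : 'I_d.+1) (a b : A) : bool :=
  [forall i, (b i : nat) == (a i + (i == j))%N].

(** Each [a] has a successor in direction [j] unless its coordinate [a j] is maximal, which happens
    for one [a] in [M + 1]. *)
Lemma sum_succ_at (j : 'I_d.+1) :
  #|A|%:R - #|A|%:R / M.+1%:R <= \sum_a \sum_b (succ_at j a b)%:R :> R.
Proof.
have -> : #|A|%:R - #|A|%:R / M.+1%:R = \sum_(a : A) (a j != ord_max)%:R :> R.
  rewrite -{2}(card_max_coordinate j) natrM mulrAC mulfV ?pnatr_eq0// mul1r.
  rewrite -sum1dep_card -(sum1_card A) !natr_sum [X in _ - X]big_mkcond -sumrB.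
  by apply: eq_bigr => a _; case: eqP; rewrite ?subrr ?subr0.
apply: ler_sum => a _; case: eqP => [_|/eqP aj]; first exact: sumr_ge0.
pose b : A := [ffun i => if i == j then inord (a i).+1 else a i].
rewrite (bigD1 b)//= (_ : succ_at j a b) ?lerDl ?sumr_ge0//.
apply/forallP => i; rewrite ffunE; have [->|_] := eqVneq i j; last by rewrite addn0.
rewrite inordK ?addn1// ltnS ltn_neqAle -ltnS ltn_ord andbT.
by apply: contra aj => /eqP E; apply/eqP/val_inj.
Qed.

(** In the sum of [w] the diagonal pairs contribute 1 and all others oscillate. In that of
    [w * ecos (x j)] the constant pairs are those of [succ_at], nearly as many. So [w] concentrates
    where every [x j] is near an integer. *)
Lemma orbit_kernel : exists w : nat -> R, (forall n, 0 <= w n) /\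
  forall e : R, 0 < e -> exists K : nat, forall k, (K <= k)%N ->
    [/\ \sum_(n < k) w n <= #|A|%:R * k%:R + #|A|%:R * (#|A|%:R * (e * k%:R)),
        #|A|%:R * k%:R - #|A|%:R * (#|A|%:R * (e * k%:R)) <= \sum_(n < k) w n &
        forall j : 'I_d.+1, (#|A|%:R - #|A|%:R / M.+1%:R) * k%:R -
          #|A|%:R * (#|A|%:R * (e * k%:R)) <= \sum_(n < k) w n * ecos (x j n)].
Proof.
exists w; split=> [n|e e0]; first by rewrite addr_ge0 ?sqr_ge0.
pose c1 (ab : A * A) (i : 'I_d.+1) : int := (ab.1 i)%:Z - (ab.2 i)%:Z.
pose c2 (jab : 'I_d.+1 * (A * A)) (i : 'I_d.+1) : int :=
  c1 jab.2 i + (i == jab.1)%:Z.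
have [K1 HK1] := common_bound (fun ab => jet_sum_oscillates (c1 ab) e0).
have [K2 HK2] := common_bound (fun jab => jet_sum_oscillates (c2 jab) e0).
exists (maxn K1 K2) => k; rewrite geq_max => /andP[K1k K2k].
have ek0 : 0 <= e * k%:R by rewrite mulr_ge0// ltW.
have thetaB (a b : A) n : theta a n - theta b n = \sum_i (c1 (a, b) i)%:~R * x i n.
  by rewrite /theta -sumrB; apply: eq_bigr => i _; rewrite -mulrBl intrB.
have sumA (y : R) : \sum_(a : A) y = #|A|%:R * y by rewrite sumr_const mulr_natl.
have wsum : \sum_(n < k) w n = \sum_a \sum_b \sum_(n < k) ecos (theta a n - theta b n).
  under eq_bigr do rewrite /w fejer0.
  rewrite exchange_big; apply: eq_bigr => a _.
  by rewrite exchange_big.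
have off (a b : A) : a != b -> `|\sum_(n < k) ecos (theta a n - theta b n)| <= e * k%:R.
  move=> ab; under eq_bigr do rewrite thetaB.
  apply: (HK1 k K1k (a, b)).
  apply: contrapT => /forallNP E; move/eqP: ab; apply; apply/ffunP => i.
  by have /negP := E i; rewrite negbK /c1 /= subr_eq0 eqz_nat => /eqP /val_inj.
have diag (a : A) : \sum_(n < k) ecos (theta a n - theta a n) = k%:R.
  by under eq_bigr do rewrite subrr ecos0; rewrite sum_const_ord mulr1.
have sumdelta (a : A) : \sum_(b : A) (if b == a then k%:R else 0 : R) = k%:R.
  by rewrite (bigD1 a)//= eqxx big1 ?addr0// => b /negPf ->.
have row (a b : A) : `|\sum_(n < k) ecos (theta a n - theta b n) -
    (if b == a then k%:R else 0)| <= e * k%:R.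
  have [->|ba] := eqVneq b a; first by rewrite diag subrr normr0.
  by rewrite subr0 off// eq_sym.
split.
- rewrite wsum -!sumA -big_split/=; apply: ler_sum => a _.
  rewrite -[X in X + _](sumdelta a) -big_split/=; apply: ler_sum => b _.
  by have := row a b; rewrite ler_norml => /andP[_]; rewrite lerBlDl.
- rewrite wsum -!sumA -sumrB; apply: ler_sum => a _.
  rewrite -[X in X - _](sumdelta a) -sumrB; apply: ler_sum => b _.
  by have := row a b; rewrite ler_norml => /andP[+ _]; rewrite lerBrDr addrC.
- move=> j.
  have -> : \sum_(n < k) w n * ecos (x j n) =
      \sum_a \sum_b \sum_(n < k) ecos (theta a n - theta b n + x j n).
    under eq_bigr do rewrite /w fejer.
    rewrite exchange_big; apply: eq_bigr => a _.
    by rewrite exchange_big.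
  apply: (@le_trans _ _ (\sum_(a : A) \sum_(b : A) ((succ_at j a b)%:R * k%:R - e * k%:R))).
    under eq_bigr do rewrite sumrB -mulr_suml sumA.
    by rewrite sumrB -mulr_suml sumA lerD2r ler_wpM2r// sum_succ_at.
  apply: ler_sum => a _; apply: ler_sum => b _.
  have E n : theta a n - theta b n + x j n = \sum_i (c2 (j, (a, b)) i)%:~R * x i n.
    rewrite thetaB; under [RHS]eq_bigr do rewrite /c2 intrD mulrDl.
    rewrite big_split/=; congr (_ + _).
    rewrite (bigD1 j)//= eqxx mul1r big1 ?addr0// => i /negPf ->.
    by rewrite mul0r.
  under eq_bigr do rewrite E.
  case: (boolP (succ_at j a b)) => [/forallP s|ns].
    rewrite mul1r; apply: (@le_trans _ _ k%:R); first by rewrite gerBl.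
    rewrite -[leLHS]mulr1 -sum_const_ord; apply: ler_sum => n _.
    rewrite big1 ?ecos0// => i _; rewrite /c2 /c1 /= (eqP (s i)) PoszD.
    by rewrite opprD addrA subrr sub0r addNr mul0r.
  rewrite mul0r sub0r lerNl; apply: le_trans (ler_norm _) _; rewrite normrN.
  apply: (HK2 k K2k (j, (a, b))).
  apply: contrapT => /forallNP F; move/negP: ns; apply; apply/forallP => i.
  have /negP := F i; rewrite negbK /c2 /c1 /= => /eqP.
  by move: (nat_of_bool (i == j)) => u h; apply/eqP; lia.
Qed.

End Orbit.

(** If every [n] had a coordinate with [chord] at least [eps], the [w]-average of the sum of the
    chords would be at least [eps]; [orbit_kernel] makes it smaller. *)
Lemma orbit_dense d (alpha : R) p (t : nat -> R) (eps : R) : irrational alpha ->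
  (forall n, iter d.+1 fdiff p n = alpha) -> 0 < eps ->
  exists n, forall j, (j < d.+1)%N -> chord (iter j fdiff p n - t j) < eps.
Proof.
move=> ia pE eps0; set D : R := d.+1%:R.
have D0 : 0 < D by rewrite ltr0n.
have [M HM] := nat_large (4 * D / eps).
pose N : R := #|{ffun 'I_d.+1 -> 'I_M.+1}|%:R.
have N0 : 0 < N by rewrite ltr0n card_ffun card_ord expn_gt0.
(* An error [delta / N] for each of the [N^2] pairs sums to [N * delta]. The final comparison is [D
   / (M + 1) + 2 D delta < eps (1 - delta)], where the first term is at most [eps / 4] and
   [delta (eps + 2 D) = eps / 4]. *)
pose delta : R := eps / (4 * (eps + 2 * D)).
have dl0 : 0 < delta by rewrite divr_gt0// mulr_gt0// addr_gt0// mulr_gt0.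
have e0 : 0 < delta / N by rewrite divr_gt0.
have [w [w0 Hw]] := orbit_kernel t ia pE M.
have [K HK] := Hw _ e0.
have := HK K.+1 (leqnSn K); have : 0 < K.+1%:R :> R by rewrite ltr0n.
rewrite -/N; move: K.+1 => k k0 [up low lowc].
apply: contrapT => /forallNP nex.
pose x (j : 'I_d.+1) n := iter j fdiff p n - t j.
have h1 : eps * \sum_(n < k) w n <=
    \sum_(j < d.+1) (\sum_(n < k) w n - \sum_(n < k) w n * ecos (x j n)).
  have -> : eps * \sum_(n < k) w n = \sum_(n < k) eps * w n by rewrite mulr_sumr.
  under [leRHS]eq_bigr do rewrite -sumrB.
  rewrite exchange_big/=; apply: ler_sum => n _.
  have [j jd hj] : exists2 j, (j < d.+1)%N & eps <= chord (iter j fdiff p n - t j).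
    apply: contrapT => F; apply: (nex n) => j jd.
    by rewrite ltNge; apply/negP => h; apply: F; exists j.
  rewrite (bigD1 (Ordinal jd))//= -[X in X - _]mulr1 -mulrBr mulrC.
  rewrite -[leLHS]addr0 lerD ?ler_wpM2l// sumr_ge0// => i _.
  by rewrite -[X in X - _]mulr1 -mulrBr mulr_ge0// chord_ge0.
have AeE : N * (N * (delta / N * k%:R)) = N * (delta * k%:R).
  by field; rewrite gt_eqF.
rewrite AeE in up low lowc.
have h2 : \sum_(j < d.+1) (\sum_(n < k) w n - \sum_(n < k) w n * ecos (x j n)) <=
    D * (N / M.+1%:R * k%:R + 2 * (N * (delta * k%:R))).
  rewrite -[leRHS](sum_const_ord d.+1); apply: ler_sum => j _.
  have lc : (N - N / M.+1%:R) * k%:R - N * (delta * k%:R) <=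
    \sum_(n < k) w n * ecos (x j n) by exact: lowc.
  move: lc up {low lowc h1}; rewrite mulrBl.
  move: (N / _) (\sum_(n < k) w n * _) (\sum_(n < k) w n) => r s1 s2 lc up.
  by lra.
have h3 : eps * (N * k%:R - N * (delta * k%:R)) <= eps * \sum_(n < k) w n.
  by rewrite ler_wpM2l// ltW.
have := le_trans h3 (le_trans h1 h2); apply/negP; rewrite -ltNge.
have Ak0 : 0 < N * k%:R :> R by rewrite mulr_gt0.
have M0 : 0 < M.+1%:R :> R by rewrite ltr0n.
have E1 : D * (N / M.+1%:R * k%:R + 2 * (N * (delta * k%:R))) =
   N * k%:R * (D / M.+1%:R + 2 * D * delta).
  by move: (M.+1%:R : R) M0 => r r0; field; rewrite gt_eqF.
have E2 : eps * (N * k%:R - N * (delta * k%:R)) =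
   N * k%:R * (eps * (1 - delta)) by ring.
rewrite E1 E2 ltr_pM2l//.
have DM : D / M.+1%:R <= eps / 4.
  have := HM M.+1 (leqnSn M); rewrite !ler_pdivrMr//; lra.
have dE : delta * (eps + 2 * D) = eps / 4.
  by rewrite /delta invfM mulrA -mulrA mulVf ?mulr1// gt_eqF// addr_gt0// mulr_gt0.
by move: (D / _) DM dE => r DM; clearbody D delta; lra.
Qed.

End Density.

(** * The words of a polynomial *)

Section OrbitCells.
Variable R : realType.
Implicit Types (x y : R) (p f g : nat -> R).

Lemma iter_fdiff_growth d f (eps : R) : 0 <= eps ->
  (forall n, iter d fdiff f n = 0) ->
  (forall j, (j < d)%N -> `|iter j fdiff f 0| <= eps) ->
  forall i j, `|iter j fdiff f i| <= 2 ^+ i * eps.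
Proof.
move=> eps0 f0 fj; elim=> [|i IH] j.
  rewrite expr0 mul1r; have [jd|dj] := ltnP j d; first exact: fj.
  by rewrite (iter_fdiff_le dj f0) normr0.
have -> : iter j fdiff f i.+1 = iter j fdiff f i + iter j.+1 fdiff f i.
  by rewrite iter_fdiffS addrC subrK.
apply: le_trans (ler_normD _ _) _; apply: le_trans (lerD (IH j) (IH j.+1)) _.
by rewrite exprS; lra.
Qed.

(** Right continuity of the floor holds at integers too, so points on a wall need no separate
    treatment. *)
Lemma floor_perturb_right x : exists2 e0 : R, 0 < e0 &
  forall e, 0 < e <= e0 -> Num.floor (x + e) = Num.floor x.
Proof.
have /andP[x1 x2] := floor_itv x.
exists (((Num.floor x + 1)%:~R - x) / 2) => [|e /andP[e0 he]].
  by rewrite divr_gt0// subr_gt0.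
by apply: floor_def; apply/andP; split; lra.
Qed.

Lemma irrational_half x : irrational x -> irrational (x / 2).
Proof.
move=> ix [q _ qE]; apply: ix; exists (q * 2) => //.
by rewrite rmorphM/= qE ratr_nat divfK ?pnatr_eq0.
Qed.

(** Halving [h] turns translations by [2 z] into translations by [z]. A jet close to that of [g']
    modulo integers yields the integer sequence [z], and the error at 0 grows at most by [2 ^ k]
    over the window. *)
Lemma orbit_hits_cell d (beta : R) k g h : irrational beta ->
  int_at d beta [::] h -> int_at d beta [::] g ->
  exists n, cell_eq d 2 (iota 0 k) (fun i => h (n + i)%N) g.
Proof.
case: d => [|d] ib [hb _] [gb _].
  exists 0%N; apply: cell_eq_floor => u _.
  by have /= -> := gb u; have /= -> := hb u.
have [gam gam0 Hgam] := common_eps (s := iota 0 k)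
  (P := fun u e => Num.floor (g u + e) = Num.floor (g u))
  (fun u _ => floor_perturb_right (g u)).
pose eps : R := gam / 8 / 2 ^+ k.
have p0 : 0 < 2 ^+ k :> R by rewrite exprn_gt0.
have eps0 : 0 < eps by rewrite !divr_gt0.
have [eta eta0 Heta] := chord_small eps0.
pose p n := 2^-1 * h n.
have pE n : iter d.+1 fdiff p n = beta / 2 by rewrite iter_fdiffZ hb mulrC.
(* The shift by [gam / 4] places [h - g - 2 z] within [gam / 4] of [gam / 2]: positive and at most
   [gam], where the floors of [g] do not change. *)
pose g' n := 2^-1 * g n + gam / 4.
have [n Hn] := orbit_dense (fun j => iter j fdiff g' 0) (irrational_half ib) pE eta0.
exists n.
have /choice[c Hc] : forall j, exists z : int, (j < d.+1)%N ->
    `|iter j fdiff p n - iter j fdiff g' 0 - z%:~R| < eps.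
  move=> j; have [jd|_] := ltnP j d.+1; last by exists 0.
  by have [z hz] := Heta _ (Hn j jd); exists z.
have [z z0 zj] := fdiff_jet_ex d.+1 c.
pose f i := p (n + i)%N - g' i - (z i)%:~R.
have zR l i : iter l fdiff (fun i => (z i)%:~R : R) i = (iter l fdiff z i)%:~R.
  by elim: l i => // l IH i; rewrite !iter_fdiffS !IH rmorphB.
have fE l i : iter l fdiff f i =
    iter l fdiff p (n + i)%N - iter l fdiff g' i - (iter l fdiff z i)%:~R.
  by rewrite -zR -iter_fdiff_shift -!iter_fdiffB.
have f0 i : iter d.+1 fdiff f i = 0.
  rewrite fE pE z0 iter_fdiffD iter_fdiffZ gb iter_fdiff_const// addr0.
  by rewrite subr0 mulrC subrr.
have fj j : (j < d.+1)%N -> `|iter j fdiff f 0| <= eps.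
  by move=> jd; rewrite fE addn0 zj// ltW// Hc.
exists z => // u uk; have := uk; rewrite mem_iota add0n => /= ltuk.
have := iter_fdiff_growth (ltW eps0) f0 fj u 0; rewrite /= => fu.
have {}fu : `|f u| <= gam / 8.
  apply: le_trans fu _; have -> : 2 ^+ u * eps = gam / 8 * (2 ^+ u / 2 ^+ k).
    by rewrite /eps; ring.
  rewrite ger_pMr; last by rewrite divr_gt0.
  by rewrite ler_pdivrMr// mul1r ler_eXn2l ?ltr1n// ltnW.
move: fu; rewrite /f /p /g' ler_norml => /andP[f1 f2].
pose e := h (n + u)%N - g u - 2 * (z u)%:~R.
have ee : 0 < e <= gam by rewrite /e; apply/andP; split; lra.
have := Hgam u e uk ee.
rewrite (_ : g u + e = h (n + u)%N + (- (2%:Z * z u))%:~R); last first.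
  by rewrite /e rmorphN/= intrM; ring.
by rewrite floorDrz ?intr_int// intrKfloor => <-; rewrite subrK.
Qed.

End OrbitCells.

(** * Parity words and the final count *)

Section PolynomialWords.
Variable R : realType.

Definition parity_word (k : nat) (g : nat -> R) : k.-tuple int :=
  [tuple (odd `|Num.floor (g i)|%N : int) | i < k].

Lemma odd_residue (a b : int) : 2 * a < b + 1 -> b < 2 * a + 2 ->
  b - 2 * a = odd `|b|%N.
Proof.
move=> lo hi; have := odd_double_half `|b|; have := leq_b1 (odd `|b|).
rewrite -muln2; move: (nat_of_bool _) (_./2) => u v hu hv.
have [E|E] : b = `|b|%N%:Z \/ b = - `|b|%N%:Z by lia.
  by lia.
by lia.
Qed.

(** [[2 {x}] = [2 x] - 2 [x]] is the residue of [[2 x]] modulo 2. *)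
Lemma polyword_parity (P : {poly R}) n :
  polyword P n = odd `|Num.floor (2 * P.[n%:~R])|%N.
Proof.
set x := P.[_].
have -> : polyword P n = Num.floor (2 * x) - 2 * Num.floor x.
  rewrite /polyword /fracp -/x mulrBr -[2 * _%:~R](_ : (2 * Num.floor x)%:~R = _).
    by rewrite -rmorphN floorDrz ?intr_int// intrKfloor.
  by rewrite intrM.
have /andP[x1 x2] := floor_itv x; have /andP[y1 y2] := floor_itv (2 * x).
move: (Num.floor x) (Num.floor (2 * x)) x1 x2 y1 y2 => a b x1 x2 y1 y2.
rewrite !intrD in x2 y2.
have lo : (2 * a)%:~R < (b + 1)%:~R :> R by rewrite intrM intrD; lra.
have hi : b%:~R < (2 * a + 2)%:~R :> R by rewrite intrD intrM; lra.
rewrite !ltr_int in lo hi.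
exact: odd_residue.
Qed.

Lemma parity_word_eq k (g h : nat -> R) : parity_word k g = parity_word k h ->
  forall i, (i < k)%N -> odd `|Num.floor (g i)| = odd `|Num.floor (h i)|.
Proof.
move=> E i ik; have := congr1 (fun t => tnth t (Ordinal ik)) E.
by rewrite !tnth_mktuple/=; do 2 case: (odd _).
Qed.

Lemma cell_eq_parity_word d k (g h : nat -> R) :
  cell_eq d 2 (iota 0 k) g h -> parity_word k g = parity_word k h.
Proof.
move=> [z _ zE]; apply: eq_from_tnth => i; rewrite !tnth_mktuple zE.
  congr (nat_of_bool _ : int).
  move: (Num.floor _) (z _) => a b.
  have := odd_double_half `|(a + 2 * b : int)%R|; have := odd_double_half `|a|.
  by rewrite -!muln2; do 2 case: (odd _); lia.
by rewrite mem_iota add0n /=.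
Qed.

Definition orbit_seq (P : {poly R}) (n : int) (i : nat) : R :=
  2 * P.[n%:~R + i%:R].

Lemma subword_orbit (P : {poly R}) k n :
  subword (polyword P) k n = parity_word k (orbit_seq P n).
Proof.
apply: eq_from_tnth => i; rewrite !tnth_mktuple polyword_parity /orbit_seq.
by rewrite intrD -pmulrn.
Qed.

Lemma int_at_orbit (P : {poly R}) d n : size P = d.+1 ->
  int_at d (2 * (d`!%:R * lead_coef P)) [::] (orbit_seq P n).
Proof.
move=> sP; split=> // i; rewrite iter_fdiffZ iter_fdiff_horner ?sP//.
by rewrite lead_coefE sP.
Qed.

Lemma card_range_inj (I : finType) (T : choiceType) (f : I -> T) : injective f ->
  #|` fset_set (range f)|%fset = #|I|.
Proof.
move=> fI; suff -> : fset_set (range f) = [fset f i | i in I]%fset.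
  by rewrite card_imfset//= -cardE.
apply/fsetP => x; rewrite in_fset_set; last exact/finite_image/finite_finset.
by apply/idP/imfsetP => [/set_mem[i _ <-]|[i _ ->]]; [exists i|apply/mem_set; exists i].
Qed.

(** The representatives of the cells give every subword, since each orbit point lies in a cell and
    each cell is visited, and give it only once by [same_code_cell_eq]. The bound [d <= k] is what
    [count_cells] asks for. *)
Lemma complexity_classes (P : {poly R}) d : size P = d.+1 ->
  irrational (lead_coef P) -> exists K : nat, forall k, (K <= k)%N ->
  complexity (polyword P) k =
    (\sum_(s <- incseqs d k) `|\det (2%:R *: binmx d s)|)%N.
Proof.
move=> sP iP; set beta := 2 * (d`!%:R * lead_coef P).
have ib : irrational beta.
  have -> : beta = (2 * d`!)%:Z%:~R * lead_coef P by rewrite /beta -pmulrn natrM mulrA.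
  by apply: irrational_scale => //; rewrite eqz_nat muln_eq0/= -lt0n fact_gt0.
have [K HK] := same_code_cell_eq d ib.
exists (maxn K d) => k; rewrite geq_max => /andP[Kk dk].
have [I [r [cI rX rE rC]]] := @count_cells R d 2 beta ib k [::] isT isT isT
  (leq_trans dk (leq_addr _ _)) (leq0n d).
rewrite cats0 subn0 in cI rE rC.
have -> : (\sum_(s <- incseqs d k) `|\det (2%:R *: binmx d s)|)%N = #|I|.
  by rewrite cI; apply: eq_bigr => s _; rewrite cats0.
rewrite /complexity.
have -> : subwords (polyword P) k = range (fun i => parity_word k (r i)).
  apply/seteqP; split=> [_ [n _ <-]|_ [i _ <-]].
    rewrite subword_orbit; have [i ri] := rC _ (int_at_orbit n sP).
    by exists i => //; rewrite (cell_eq_parity_word ri).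
  (* The forward orbit from 0 already visits every cell. *)
  have [n hn] := orbit_hits_cell k ib (int_at_orbit 0 sP) (rX i).
  exists n%:Z => //; rewrite subword_orbit -(cell_eq_parity_word hn).
  congr (parity_word k _); apply/funext => j.
  by rewrite /orbit_seq add0r natrD.
rewrite card_range_inj// => i j E; apply: rE; apply: (HK k Kk) => //.
exact: parity_word_eq.
Qed.

End PolynomialWords.

(** The count of cells uses only the irrationality of [beta], so [Q] is fixed before [P] is
    chosen. *)
Theorem theorem1p1 (R : realType) (d : nat) :
  exists Q : {poly R}, forall P : {poly R},
    size P = d.+1 -> irrational (lead_coef P) ->
    exists K : nat, forall k : nat, (K <= k)%N ->
      (complexity (polyword P) k)%:R = Q.[k%:R].
Proof.
have [Q HQ] := det_incseqs_poly R d 2; exists Q => P sP iP.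
have [K HK] := complexity_classes sP iP.
by exists K => k Kk; rewrite HK// HQ.
Qed.
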